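(* Let $U\subset\mathbb{R}^n$ be a smoothly bounded strictly convex domain and let $u_0,u_1\in\tilde{\mathcal S}$. Let $u\in C(\overline{U\times(0,1)})$, convex in $U\times(0,1)$, be the solution of the Dirichlet problem $$\det(D^2_{x,t}u)=0\ \text{in } U\times(0,1),\quad u=u_0\ \text{on } U\times\{0\},\quad u=u_1\ \text{on } U\times\{1\},\quad u=0\ \text{on } \partial U\times(0,1).$$ Then $u$ is globally Lipschitz and belongs to $C^{1,1}_{loc}(U\times(0,1))$. Moreover, $u$ is globally $C^{1,1}$ in $U\times(0,1)$ if and only if the gradient images of $u_0$ and $u_1$ agree, i.e. $\partial u_0(U)=\partial u_1(U)$.
   Context: The space $\tilde{\mathcal S}$ is $$\tilde{\mathcal S}:=\{u\in C^\infty(U)\cap C(\overline U)\ |\ D^2u>0 \text{ on } U,\ \|u\|_{C^2}<\infty,\ u=0 \text{ on } \partial U\},$$ where $\|\cdot\|_{C^2}$ is the $C^2$ norm over $U$ and $D^2u>0$ means that the Hessian is positive definite at every point of the open set $U$ (its smallest eigenvalue may tend to $0$ at $\partial U$). $D^2_{x,t}u$ is the Hessian of $u$ in the joint variables $(x,t)\in U\times(0,1)$. The equation $\det(D^2_{x,t}u)=0$ is understood in the generalized (Alexandrov) sense for convex functions; the convex generalized solution $u$ of this Dirichlet problem exists and is unique, and is called the (weak) geodesic joining $u_0$ and $u_1$. $\partial u_j(U)$ is the image of $U$ under the subdifferential of $u_j$; here it equals $\{Du_j(x): x\in U\}$. ''Globally $C^{1,1}$ in $U\times(0,1)$'' means that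 $u\in C^{1,1}$ with bounded $C^{1,1}$ norm on all of $U\times(0,1)$ (gradient Lipschitz with one constant on the whole set). *)

(* Defs.v *)
From HB Require Import structures.
From mathcomp Require Import all_boot all_order all_algebra.
From mathcomp Require Import all_classical all_reals all_analysis.

Set Implicit Arguments.
Unset Strict Implicit.
Unset Printing Implicit Defensive.
Import Order.TTheory GRing.Theory Num.Theory.
Import numFieldNormedType.Exports.

Local Open Scope classical_set_scope.
Local Open Scope ring_scope.

(* The library norm on 'rV[R]_m is the sup norm. It only enters below through
   openness, boundedness and Lipschitz conditions, all of which are insensitive
   to replacing it by the Euclidean norm. *)

Definition dotprod (R : realType) (m : nat) (p x : 'rV[R]_m) : R :=
  \sum_(i < m) p 0 i * x 0 i.

Definition boundary (T : topologicalType) (A : set T) : set T :=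
  closure A `\` A°.

Definition partial (R : realType) (m : nat) (i : 'I_m) (f : 'rV[R]_m -> R) :
    'rV[R]_m -> R :=
  'D_(delta_mx 0 i) f.

(* partials [:: i1; ...; ik] f = D_i1 (... (D_ik f)) *)
Definition partials (R : realType) (m : nat) (s : seq 'I_m)
    (f : 'rV[R]_m -> R) : 'rV[R]_m -> R :=
  foldr (@partial R m) f s.

Definition grad (R : realType) (m : nat) (f : 'rV[R]_m -> R) (x : 'rV[R]_m) :
    'rV[R]_m :=
  \row_i partial i f x.

Definition hessian (R : realType) (m : nat) (f : 'rV[R]_m -> R)
    (x : 'rV[R]_m) : 'M[R]_m :=
  \matrix_(i, j) partials [:: i; j] f x.

Definition posdefmx (R : realType) (m : nat) (A : 'M[R]_m) : Prop :=
  A^T = A /\ forall v : 'rV[R]_m, v != 0 -> 0 < (v *m A *m v^T) 0 0.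

(* f in C^oo(U), for U open; the values of f off U are irrelevant. *)
Definition Cinfty (R : realType) (m : nat) (U : set 'rV[R]_m)
    (f : 'rV[R]_m -> R) : Prop :=
  forall (s : seq 'I_m) (x : 'rV[R]_m), U x ->
    {for x, continuous (partials s f)} /\
    forall i : 'I_m, derivable (partials s f) x (delta_mx 0 i).

(* Supremum over U of the partial derivatives of order at most k. *)
Definition Ck_norm (R : realType) (m k : nat) (U : set 'rV[R]_m)
    (f : 'rV[R]_m -> R) : \bar R :=
  ereal_sup [set `|partials sx.1 f sx.2|%:E |
             sx in [set sx : seq 'I_m * 'rV[R]_m |
                    (size sx.1 <= k)%N /\ U sx.2]].

(* U lies locally on one side of its boundary: near each boundary point it is
   a strict sublevel set of a smooth function with nonvanishing gradient. *)
Definition smooth_boundary (R : realType) (m : nat) (U : set 'rV[R]_m) : Prop :=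
  forall p : 'rV[R]_m, boundary U p ->
    exists (V : set 'rV[R]_m) (rho : 'rV[R]_m -> R),
      [/\ open V, V p, Cinfty V rho, grad rho p != 0 &
          U `&` V = [set x | V x /\ rho x < 0]].

(* Open chords of the closure lie in U, i.e. U is convex and its boundary
   contains no segment; no lower bound on the curvature of the boundary is
   assumed. *)
Definition strictly_convex (R : realType) (m : nat) (U : set 'rV[R]_m) : Prop :=
  forall (x y : 'rV[R]_m) (s : R), closure U x -> closure U y -> x != y ->
    0 < s < 1 -> U ((1 - s) *: x + s *: y).

(* Connectedness follows from strict convexity. *)
Definition smooth_strictly_convex_domain (R : realType) (m : nat)
    (U : set 'rV[R]_m) : Prop :=
  [/\ open U, U !=set0, bounded_set U, smooth_boundary U & strictly_convex U].

Definition in_tildeS (R : realType) (m : nat) (U : set 'rV[R]_m)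
    (f : 'rV[R]_m -> R) : Prop :=
  [/\ Cinfty U f, {within closure U, continuous f},
      forall x, U x -> posdefmx (hessian f x),
      (Ck_norm 2 U f < +oo)%E &
      forall x, boundary U x -> f x = 0].

Definition subdifferential (R : realType) (m : nat) (Omega : set 'rV[R]_m)
    (f : 'rV[R]_m -> R) (x : 'rV[R]_m) : set 'rV[R]_m :=
  [set p | forall y, Omega y -> f x + dotprod p (y - x) <= f y].

Definition subdiff_image (R : realType) (m : nat) (Omega : set 'rV[R]_m)
    (f : 'rV[R]_m -> R) (E : set 'rV[R]_m) : set 'rV[R]_m :=
  \bigcup_(x in E) subdifferential Omega f x.

Definition box (R : realType) (m : nat) (a b : 'rV[R]_m) : set 'rV[R]_m :=
  [set x | forall i, a 0 i <= x 0 i <= b 0 i].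

Definition box_volume (R : realType) (m : nat) (a b : 'rV[R]_m) : R :=
  \prod_(i < m) (b 0 i - a 0 i).

(* The m-dimensional Lebesgue outer measure; on measurable sets it is the
   Lebesgue measure. *)
Definition lebesgue_outer (R : realType) (m : nat) (A : set 'rV[R]_m) : \bar R :=
  ereal_inf [set (\sum_(0 <= k <oo) (box_volume (ab k).1 (ab k).2)%:E)%E |
    ab in [set ab : nat -> 'rV[R]_m * 'rV[R]_m |
           (forall k i, (ab k).1 0 i <= (ab k).2 0 i) /\
           A `<=` \bigcup_k box (ab k).1 (ab k).2]].

Definition monge_ampere (R : realType) (m : nat) (Omega : set 'rV[R]_m)
    (f : 'rV[R]_m -> R) (E : set 'rV[R]_m) : \bar R :=
  lebesgue_outer (subdiff_image Omega f E).

(* det D^2 f = 0 in Omega in the Alexandrov sense, for f convex: the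
   Monge-Ampere measure of f vanishes on the Borel subsets of Omega. *)
Definition alexandrov_det_hessian_eq0 (R : realType) (m : nat)
    (Omega : set 'rV[R]_m) (f : 'rV[R]_m -> R) : Prop :=
  forall E : set 'rV[R]_m, <<s [set O : set 'rV[R]_m | open O] >> E ->
    E `<=` Omega -> monge_ampere Omega f E = 0%E.

Definition xt (R : realType) (n : nat) (x : 'rV[R]_n) (t : R) : 'rV[R]_(n + 1) :=
  row_mx x (const_mx t).

(* The image of U x (0,1) in R^(n+1) *)
Definition cylinder (R : realType) (n : nat) (U : set 'rV[R]_n) :
    set 'rV[R]_(n + 1) :=
  [set xt x t | x in U & t in [set t : R | 0 < t < 1]].

Definition weak_geodesic (R : realType) (n : nat) (U : set 'rV[R]_n)
    (u0 u1 : 'rV[R]_n -> R) (u : 'rV[R]_(n + 1) -> R) : Prop :=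
  [/\ {within closure (cylinder U), continuous u},
      convex_function (cylinder U) u,
      alexandrov_det_hessian_eq0 (cylinder U) u,
      (forall x, U x -> u (xt x 0) = u0 x /\ u (xt x 1) = u1 x) &
      (forall x t, boundary U x -> 0 < t < 1 -> u (xt x t) = 0)].

(* C^{1,1}(Omega) with finite C^{1,1} norm *)
Definition C11 (R : realType) (m : nat) (Omega : set 'rV[R]_m)
    (f : 'rV[R]_m -> R) : Prop :=
  [/\ forall x, Omega x -> differentiable f x,
      [bounded f x | x in Omega],
      [bounded grad f x | x in Omega] &
      [lipschitz grad f x | x in Omega]].

Definition C11_loc (R : realType) (m : nat) (Omega : set 'rV[R]_m)
    (f : 'rV[R]_m -> R) : Prop :=
  forall V : set 'rV[R]_m, open V -> compact (closure V) ->
    closure V `<=` Omega -> C11 V f.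

(* Main.v *)
(* The geodesic is the convex envelope of its boundary values,
     u(x, t) = min { (1 - t) u0(x0) + t u1(x1) : (1 - t) x0 + t x1 = x },
   the minimum being over the closure of U.  It is attained at pairs (x0, x1) of
   which at least one member is interior, and such pairs have a common
   subgradient p; the affine function in (y, s) that interpolates the supporting
   hyperplanes of u0 at x0 and of u1 at x1 lies below the boundary values, hence
   below u by Alexandrov's argument, and touches u at (x, t).  Its slopes are
   bounded, so u is Lipschitz.  Moving an interior minimizer gives a quadratic
   upper bound on u minus this affine function, which makes u differentiable with
   Lipschitz gradient; the constant is uniform away from the boundary of the
   cylinder, and globally uniform when both minimizers are always interior, which
   is what equality of the gradient images means.  Conversely, if p = Du1(x1) is
   not a gradient of u0 on U, then u0 - p attains its minimum at a boundary point
   x0, and so does u0 - (1 + e) p because p . (y - x0) <= u0(y) <= 0 on U.  For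
   small e the slope (1 + e) p is also a gradient of u1, so that two segments
   issued from (x0, 0) carry the distinct gradients p and (1 + e) p, and the
   gradient of u cannot be Lipschitz. *)

Require Import Defs.
From HB Require Import structures.
From mathcomp Require Import all_boot all_order all_algebra.
From mathcomp Require Import all_classical all_reals all_analysis.
From mathcomp Require Import measurable_realfun ring lra.

Set Implicit Arguments.
Unset Strict Implicit.
Unset Printing Implicit Defensive.
Import Order.TTheory GRing.Theory Num.Theory.
Import numFieldNormedType.Exports.

Local Open Scope classical_set_scope.
Local Open Scope ring_scope.

(** * Dot products against the sup norm *)

Section dotprod.
Context (R : realType) (m : nat).
Implicit Types p q x y : 'rV[R]_m.

Lemma dotprodDl p q x : dotprod (p + q) x = dotprod p x + dotprod q x.
Proof.
by rewrite /dotprod -big_split; apply: eq_bigr => i _; rewrite mxE mulrDl.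
Qed.

Lemma dotprodDr p x y : dotprod p (x + y) = dotprod p x + dotprod p y.
Proof.
by rewrite /dotprod -big_split; apply: eq_bigr => i _; rewrite mxE mulrDr.
Qed.

Lemma dotprodZl a p x : dotprod (a *: p) x = a * dotprod p x.
Proof.
by rewrite /dotprod mulr_sumr; apply: eq_bigr => i _; rewrite mxE mulrA.
Qed.

Lemma dotprodZr a p x : dotprod p (a *: x) = a * dotprod p x.
Proof.
by rewrite /dotprod mulr_sumr; apply: eq_bigr => i _; rewrite mxE mulrCA.
Qed.

Lemma dotprodNl p x : dotprod (- p) x = - dotprod p x.
Proof. by rewrite -scaleN1r dotprodZl mulN1r. Qed.

Lemma dotprodNr p x : dotprod p (- x) = - dotprod p x.
Proof. by rewrite -scaleN1r dotprodZr mulN1r. Qed.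

Lemma dotprodBl p q x : dotprod (p - q) x = dotprod p x - dotprod q x.
Proof. by rewrite dotprodDl dotprodNl. Qed.

Lemma dotprodBr p x y : dotprod p (x - y) = dotprod p x - dotprod p y.
Proof. by rewrite dotprodDr dotprodNr. Qed.

Lemma dotprod0l x : dotprod 0 x = 0.
Proof. by rewrite -(scale0r 0) dotprodZl mul0r. Qed.

Lemma dotprod0r p : dotprod p 0 = 0.
Proof. by rewrite -(scale0r 0) dotprodZr mul0r. Qed.

Lemma dotprod_delta p i : dotprod p (delta_mx 0 i) = p 0 i.
Proof.
rewrite /dotprod (bigD1 i)//= mxE !eqxx mulr1 big1 ?addr0// => j ji.
by rewrite mxE eqxx /= (negbTE ji) mulr0.
Qed.

Lemma coord_le_norm x i : `|x 0 i| <= `|x|.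
Proof.
rewrite [leRHS]/Num.norm /= mx_normrE.
by apply: (le_bigmax _ (fun ij : 'I_1 * 'I_m => `|x ij.1 ij.2|) (0, i)).
Qed.

Lemma norm_le_coord x (e : R) :
  0 <= e -> (forall i, `|x 0 i| <= e) -> `|x| <= e.
Proof.
move=> e0 xe; rewrite [leLHS]/Num.norm /= mx_normrE.
by apply/bigmax_leP; split => // -[i j] _ /=; rewrite (ord1 i).
Qed.

(** The factor [m] comes from bounding each of the [m] terms by the product of the sup norms; it
    reappears in many constants below. *)
Lemma norm_dotprod p x : `|dotprod p x| <= m%:R * `|p| * `|x|.
Proof.
apply: le_trans (ler_norm_sum _ _ _) _.
apply: (@le_trans _ _ (\sum_(i < m) `|p| * `|x|)).
  by apply: ler_sum => i _; rewrite normrM ler_pM// coord_le_norm.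
by rewrite sumr_const card_ord -[leLHS]mulr_natl mulrA.
Qed.

Lemma norm_delta i : `|delta_mx 0 i : 'rV[R]_m| <= 1.
Proof.
apply: norm_le_coord => // j; rewrite mxE /=.
by case: (_ == _); rewrite ?normr1 ?normr0.
Qed.

End dotprod.

(** * The mean value theorem along a segment *)

Section mean_value.
Context (R : realType) (V : normedModType R).
Implicit Types (f : V -> R) (x v : V).

Lemma is_derive_line f x v (s : R) d :
  is_derive (x + s *: v) v f d -> is_derive s 1 (fun r => f (x + r *: v)) d.
Proof.
have E : (fun h : R => h^-1 *: (((fun r => f (x + r *: v)) \o shift s) (h *: 1) -
     f (x + s *: v))) =
     (fun h => h^-1 *: ((f \o shift (x + s *: v)) (h *: v) - f (x + s *: v))).
  apply/funext => h /=; congr (_ *: (f _ - _)).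
  by rewrite [_ *: 1]mulr1 scalerDl addrCA.
move=> [dfv <-]; apply: DeriveDef; first by rewrite /derivable E.
by rewrite /derive E.
Qed.

Lemma is_derive_line_inv f x v (s : R) d :
  is_derive s 1 (fun r => f (x + r *: v)) d -> is_derive (x + s *: v) v f d.
Proof.
have E : (fun h : R => h^-1 *: (((fun r => f (x + r *: v)) \o shift s) (h *: 1) -
     f (x + s *: v))) =
     (fun h => h^-1 *: ((f \o shift (x + s *: v)) (h *: v) - f (x + s *: v))).
  apply/funext => h /=; congr (_ *: (f _ - _)).
  by rewrite [_ *: 1]mulr1 scalerDl addrCA.
move=> [dfv <-]; apply: DeriveDef; first by rewrite /derivable -E.
by rewrite /derive -E.
Qed.

Lemma is_deriveZv f x v a d : is_derive x v f d -> is_derive x (a *: v) f (a * d).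
Proof.
move=> dfv; rewrite -[x]addr0 -(scale0r (a *: v)); apply: is_derive_line_inv.
have -> : (fun r => f (x + r *: (a *: v))) =
    (fun r => f (x + r *: v)) \o (fun r => r * a).
  by apply/funext => r /=; rewrite scalerA.
rewrite mulrC; apply: is_derive1_comp.
  by apply: is_derive_line; rewrite mul0r scale0r addr0.
by apply: is_derive_eq; rewrite scaler0 add0r [_ *: _]mulr1.
Qed.

Lemma mean_value_line f x v (df : R -> R) :
  (forall s : R, 0 <= s <= 1 -> is_derive (x + s *: v) v f (df s)) ->
  exists2 s, 0 < s < 1 & f (x + v) - f x = df s.
Proof.
move=> dfs; pose g r := f (x + r *: v).
have dg (s : R) : 0 <= s <= 1 -> is_derive s 1 g (df s).
  by move=> s01; apply: is_derive_line; exact: dfs.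
have [s||s] := @MVT R g df 0 1 ltr01.
- by rewrite in_itv/= => /andP[/ltW ? /ltW ?]; apply: dg; apply/andP.
- apply: derivable_within_continuous => s; rewrite in_itv/= => s01.
  by have [] := dg _ s01.
by rewrite in_itv/= subr0 mulr1 /g scale1r scale0r addr0 => s01 E; exists s.
Qed.

End mean_value.

(** * Directional derivatives of functions with continuous partial derivatives *)

Section C1.
Context (R : realType) (m : nat).
Implicit Types (f : 'rV[R]_m -> R) (x v h : 'rV[R]_m).

Lemma partial_mean_value f x i (a : R) :
  (forall s : R, 0 <= s <= 1 ->
    derivable f (x + s *: (a *: delta_mx 0 i)) (delta_mx 0 i)) ->
  exists2 s, 0 < s < 1 & f (x + a *: delta_mx 0 i) - f x =
    a * partial i f (x + s *: (a *: delta_mx 0 i)).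
Proof.
move=> df; apply: (mean_value_line (df := fun s =>
  a * partial i f (x + s *: (a *: delta_mx 0 i)))) => s s01.
by apply: is_deriveZv; apply: derivableP; exact: df.
Qed.

Lemma row_sum_subseq_norm (s : seq 'I_m) (v : 'rV[R]_m) :
  `|\sum_(i <- s) v 0 i *: delta_mx 0 i : 'rV[R]_m| <= (size s)%:R * `|v|.
Proof.
elim: s => [|i s IH]; first by rewrite big_nil normr0 mul0r.
rewrite big_cons /= -natr1 mulrDl mul1r addrC.
apply: le_trans (ler_normD _ _) _; rewrite lerD// normrZ.
rewrite -[leRHS]mulr1 ler_pM// ?coord_le_norm// norm_delta//.
Qed.

(** The coordinates of the increment are added one at a time along the list [s]; each addition uses
    one mean value whose intermediate point is close to [x]. Arbitrary lists make the induction
    possible, and the full expansion is the case of the list of all indices. *)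
Lemma C1_expansion f x (U : set 'rV[R]_m) : open U -> U x ->
  (forall y i, U y -> derivable f y (delta_mx 0 i)) ->
  (forall i, {for x, continuous (partial i f)}) ->
  forall (s : seq 'I_m) (e : R), 0 < e -> exists2 d : R, 0 < d &
  forall v : 'rV[R]_m, `|v| < d ->
    `|f (x + \sum_(i <- s) v 0 i *: delta_mx 0 i) - f x -
     \sum_(i <- s) v 0 i * partial i f x| <= e * `|v|.
Proof.
move=> oU Ux df cf; elim=> [|i s IH] e e0.
  exists 1 => // v _; rewrite !big_nil addr0 subrr subr0 normr0.
  by rewrite mulr_ge0// ltW.
have e20 : 0 < e / 2 by rewrite divr_gt0.
have [d1 d10 H1] := IH (e / 2) e20.
have /nbhs_ballP[r /= r0 rU] : nbhs x U by apply: open_nbhs_nbhs.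
have /cvgrPdist_le/(_ _ e20)/nbhs_ballP[r2 /= r20 cr2] := cf i.
(* The partial increments along [i :: s] are at most [k] times the norm of [v], so every
   intermediate point stays within [rr] of [x]. *)
pose k : R := (size s)%:R + 1.
have k0 : 0 < k by rewrite ltr_wpDl.
pose rr := Num.min r r2.
have rr0 : 0 < rr by rewrite lt_min r0.
exists (Num.min d1 (rr / k)); first by rewrite lt_min d10 divr_gt0.
move=> v; rewrite lt_min => /andP[vd1 vrr].
rewrite !big_cons; set w := \sum_(j <- s) _ *: _.
have near_x (t : R) : 0 <= t <= 1 ->
    `|x + w + t *: (v 0 i *: delta_mx 0 i) - x| < rr.
  move=> /andP[t0 t1].
  have -> : x + w + t *: (v 0 i *: delta_mx 0 i) - x =
      w + t *: (v 0 i *: delta_mx 0 i) by rewrite -(addrA x) [x + _]addrC addrK.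
  apply: le_lt_trans (ler_normD _ _) _.
  apply: (@le_lt_trans _ _ (k * `|v|)); last by rewrite mulrC -ltr_pdivlMr.
  rewrite mulrDl lerD ?row_sum_subseq_norm// mul1r normrZ normrZ.
  apply: le_trans (ler_piMl _ _) _; rewrite ?mulr_ge0 ?(ger0_norm t0)//.
  by apply: le_trans (ler_piMr _ _) _; rewrite ?coord_le_norm ?norm_delta.
have [t t01|t t01 E] := @partial_mean_value f (x + w) i (v 0 i).
  apply: df; apply: rU; rewrite -ball_normE /= distrC.
  by have := near_x t t01; rewrite lt_min => /andP[].
have t01' : 0 <= t <= 1 by move: t01 => /andP[/ltW -> /ltW ->].
rewrite [_ *: _ + w]addrC addrA.
have -> : f (x + w + v 0 i *: delta_mx 0 i) - f x -
    (v 0 i * partial i f x + \sum_(j <- s) v 0 j * partial j f x) =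
  (f (x + w) - f x - \sum_(j <- s) v 0 j * partial j f x) +
  (f (x + w + v 0 i *: delta_mx 0 i) - f (x + w) - v 0 i * partial i f x).
  by ring.
rewrite E -mulrBr (splitr e) mulrDl.
apply: le_trans (ler_normD _ _) _; rewrite lerD ?H1//.
rewrite normrM mulrC ler_pM ?coord_le_norm// distrC.
apply: cr2; rewrite -ball_normE /= distrC.
by have := near_x t t01'; rewrite lt_min => /andP[].
Qed.

Lemma row_sum_coord v : v = \sum_i v 0 i *: delta_mx 0 i.
Proof. by rewrite {1}[v]matrix_sum_delta big_ord1. Qed.

Lemma C1_is_derive f (U : set 'rV[R]_m) x v : open U -> U x ->
  (forall y i, U y -> derivable f y (delta_mx 0 i)) ->
  (forall i, {for x, continuous (partial i f)}) ->
  is_derive x v f (dotprod (grad f x) v).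
Proof.
move=> oU Ux df cf.
suff H : h^-1 *: ((f \o shift x) (h *: v) - f x) @[h --> 0^'] -->
    dotprod (grad f x) v.
  by apply: DeriveDef; [apply/cvg_ex; eexists; exact: H|exact: cvg_lim H].
apply/cvgrPdist_le => e e0.
have v0 : 0 < `|v| + 1 by rewrite ltr_wpDl.
have e'0 : 0 < e / (`|v| + 1) by rewrite divr_gt0.
have [d d0 H] := C1_expansion oU Ux df cf (index_enum 'I_m) e'0.
rewrite near_withinE; apply/nbhs_ballP; exists (d / (`|v| + 1)) => /=.
  by rewrite divr_gt0.
move=> h; rewrite -ball_normE /= sub0r normrN => hd h0.
have hv : `|h *: v| < d.
  rewrite normrZ; apply: (@le_lt_trans _ _ (`|h| * (`|v| + 1))).
    by rewrite ler_wpM2l// lerDl.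
  by rewrite -ltr_pdivlMr.
have := H _ hv; rewrite -row_sum_coord.
have -> : \sum_i (h *: v) 0 i * partial i f x = h * dotprod (grad f x) v.
  rewrite /dotprod mulr_sumr; apply: eq_bigr => i _.
  by rewrite !mxE -mulrA [v 0 i * _]mulrC.
move=> Hle; rewrite /shift/= [h *: v + x]addrC distrC.
have -> : h^-1 *: (f (x + h *: v) - f x) - dotprod (grad f x) v =
   h^-1 * (f (x + h *: v) - f x - h * dotprod (grad f x) v).
  by rewrite /GRing.scale/=; field.
rewrite normrM normfV ler_pdivrMl ?normr_gt0//; apply: le_trans Hle _.
rewrite normrZ mulrCA ler_wpM2l// mulrAC ler_pdivrMr// ler_wpM2l ?ltW//.
by rewrite ltrDl.
Qed.

End C1.

(** * Second order expansions *)

Section second_order.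
Context (R : realType) (m : nat).
Implicit Types (f : 'rV[R]_m -> R) (x y v h : 'rV[R]_m) (U : set 'rV[R]_m).

Lemma Cinfty_is_derive U f s x v : open U -> Cinfty U f -> U x ->
  is_derive x v (partials s f) (dotprod (grad (partials s f) x) v).
Proof.
move=> oU Cf Ux; apply: (C1_is_derive _ oU Ux) => [y i Uy|i].
  by have [_] := Cf s y Uy; exact.
by have [] := Cf (i :: s) x Ux.
Qed.

Lemma quad_hessianE f x h :
  (h *m hessian f x *m h^T) 0 0 =
  \sum_i h 0 i * dotprod (grad (partial i f) x) h.
Proof.
rewrite mxE; apply: eq_bigr => i _; rewrite !mxE mulrC; congr (_ * _).
by rewrite /dotprod; apply: eq_bigr => j _; rewrite !mxE mulrC.
Qed.

(** Two nested mean value theorems, for [f] and then for its derivative along [h], replace Taylor's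
    formula. The factor 1/2 is traded for an unspecified [s.1] in (0,1), which is enough for a sign
    and for an upper bound. *)
Lemma second_mean_value U f x h : open U -> Cinfty U f ->
  (forall s : R, 0 <= s <= 1 -> U (x + s *: h)) ->
  exists s : R * R, [/\ 0 < s.1 < 1, 0 < s.2 < 1 &
    f (x + h) - f x - dotprod (grad f x) h =
    s.1 * (h *m hessian f (x + s.2 *: h) *m h^T) 0 0].
Proof.
move=> oU Cf Uxh.
have [s s01 Es] := mean_value_line (fun s s01 =>
  Cinfty_is_derive [::] h oU Cf (Uxh s s01)).
pose F z := dotprod (grad f z) h.
have dF z : U z -> is_derive z h F ((h *m hessian f z *m h^T) 0 0).
  move=> Uz; rewrite quad_hessianE.
  have -> : F = \sum_i (fun z => h 0 i * partial i f z).
    apply/funext => w; rewrite /F /dotprod fct_sumE.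
    by apply: eq_bigr => i _; rewrite mxE mulrC.
  apply: is_derive_sum => i.
  have /= := Cinfty_is_derive [:: i] h oU Cf Uz.
  by move=> d; exact: (@is_deriveZ _ _ _ (partial i f) (h 0 i)).
have Us r : 0 <= r <= 1 -> 0 <= r * s <= 1.
  case/andP=> r0 r1; case/andP: s01 => s0 s1.
  by rewrite mulr_ge0 ?mulr_ile1 ?(ltW s0) ?(ltW s1).
have dFs r : 0 <= r <= 1 -> is_derive (x + r *: (s *: h)) (s *: h) F
    (s * (h *m hessian f (x + r *: (s *: h)) *m h^T) 0 0).
  move=> r01; apply: is_deriveZv; apply: dF.
  by rewrite scalerA; apply: Uxh; apply: Us.
have [r r01 Er] := mean_value_line dFs.
exists (s, r * s); split; [exact: s01| |].
  case/andP: r01 => r0 r1; case/andP: s01 => s0 s1.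
  by apply/andP; split; [exact: mulr_gt0|apply: mulr_ilt1 => //; exact: ltW].
have -> : f (x + h) - f x = F (x + s *: h) by exact: Es.
by rewrite -[(r * s) *: h]scalerA; exact: Er.
Qed.

Lemma Ck_norm_partials k U f : (Ck_norm k U f < +oo)%E ->
  exists2 M : R, 0 <= M & forall s x, (size s <= k)%N -> U x ->
    `|partials s f x| <= M.
Proof.
move=> fk; exists (Num.max 0 (fine (Ck_norm k U f))).
  by rewrite le_max lexx.
move=> s x sk Ux; rewrite le_max; apply/orP; right.
have le1 : (`|partials s f x|%:E <= Ck_norm k U f)%E.
  by apply: ereal_sup_ubound; exists (s, x).
by rewrite -lee_fin fineK// fin_numE gt_eqF ?(lt_le_trans _ le1) ?ltNyr// lt_eqF.
Qed.

End second_order.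

(* All that is used of a function in S~ besides its boundary values: a strict
   supporting hyperplane and a quadratic upper bound at every interior point. *)
Definition pinched (R : realType) (m : nat) (U : set 'rV[R]_m)
    (f : 'rV[R]_m -> R) (C L : R) : Prop :=
  (forall x, U x -> `|grad f x| <= L) /\
  forall x y, U x -> U y -> x != y ->
    f x + dotprod (grad f x) (y - x) < f y <=
    f x + dotprod (grad f x) (y - x) + C * `|y - x| ^+ 2.

(** Positive definiteness of the Hessian gives the strict inequality, the bound on the second
    derivatives gives the quadratic one: a form with entries at most [M] is at most [m * m * M]
    times the squared sup norm. *)
Lemma tildeS_pinched (R : realType) (m : nat) (U : set 'rV[R]_m)
    (f : 'rV[R]_m -> R) : open U ->
  (forall x y (s : R), U x -> U y -> 0 <= s <= 1 -> U (x + s *: (y - x))) ->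
  in_tildeS U f -> exists C L : R, [/\ 0 <= C, 0 <= L & pinched U f C L].
Proof.
move=> oU cU [Cf _ Hf /Ck_norm_partials[M M0 fM] _].
exists (m%:R * m%:R * M), M; split => //; first by rewrite !mulr_ge0.
split=> [x Ux|x y Ux Uy xy].
  by apply: norm_le_coord => // i; rewrite mxE; exact: (fM [:: i]).
have Uh (s : R) : 0 <= s <= 1 -> U (x + s *: (y - x)) by move=> ?; exact: cU.
have [[s r] /= [/andP[s0 s1] r01 E]] := second_mean_value oU Cf Uh.
have {E}-> : f y = f x + dotprod (grad f x) (y - x) +
   s * ((y - x) *m hessian f (x + r *: (y - x)) *m (y - x)^T) 0 0.
  by rewrite -E [x + (y - x)]addrC subrK; ring.
have Uz : U (x + r *: (y - x)).
  by case/andP: r01 => /ltW r0 /ltW r1; apply: cU => //; rewrite r0.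
rewrite ltrDl lerD2l; apply/andP; split.
  by apply: mulr_gt0 => //; apply: (Hf _ Uz).2; rewrite subr_eq0 eq_sym.
rewrite (le_trans (ler_norm _))// normrM -[leRHS]mul1r ler_pM//.
  by rewrite ger0_norm ltW.
rewrite quad_hessianE (le_trans (ler_norm_sum _ _ _))//.
apply: (@le_trans _ _ (\sum_(i < m) `|y - x| * (m%:R * M * `|y - x|))).
  apply: ler_sum => i _; rewrite normrM ler_pM ?coord_le_norm//.
  rewrite (le_trans (norm_dotprod _ _))// ler_wpM2r// ler_wpM2l//.
  by apply: norm_le_coord => // j; rewrite mxE; exact: (fM [:: j; i]).
rewrite sumr_const card_ord -[leLHS]mulr_natl le_eqVlt; apply/orP; left; apply/eqP; ring.
Qed.

(** * Lebesgue outer measure of boxes *)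

Section outer_measure_box.
Context (R : realType).

(* The weights [w] make the induction on the dimension possible: the slice of
   the covering at height [t] is the same sequence of boxes, in one dimension
   less, with the weight of the boxes that miss the slice set to zero. *)
Lemma weighted_box_cover m (a b : 'I_m -> R) (w : nat -> R)
    (c d : nat -> 'I_m -> R) :
  (forall i, a i <= b i) -> (forall k, 0 <= w k) ->
  (forall k i, c k i <= d k i) ->
  (forall x : 'I_m -> R, (forall i, a i <= x i <= b i) ->
    exists2 k, 1 <= w k & forall i, c k i <= x i <= d k i) ->
  ((\prod_(i < m) (b i - a i))%:E <=
   \sum_(0 <= k <oo) (w k * \prod_(i < m) (d k i - c k i))%:E)%E.
Proof.
elim: m a b w c d => [|m IH] a b w c d ab w0 cd cov.
  (* In dimension zero the box is a single point, and one member of weight at least 1 already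
     accounts for the empty product. *)
  have [x|k wk _] := cov a; first by rewrite lexx ab.
  rewrite big_ord0; pose u k := (w k * \prod_(i < 0) (d k i - c k i))%:E.
  have u0 k' : (0 <= u k')%E by rewrite /u lee_fin big_ord0 mulr1.
  apply: le_trans (nneseries_lim_ge k.+1 (fun k' _ _ => u0 k')).
  rewrite big_nat_recr//= -[leLHS]add0e leeD ?sume_ge0//.
  by rewrite lee_fin big_ord0 mulr1.
pose D := `[a ord0, b ord0]%classic.
pose Ik k := `[c k ord0, d k ord0]%classic.
pose vol k := \prod_(i < m) (d k (lift ord0 i) - c k (lift ord0 i)).
have vol0 k : 0 <= vol k by apply: prodr_ge0 => i _; rewrite subr_ge0.
pose g k t := (w k * \1_(Ik k) t * vol k)%:E.
have mD : measurable D by exact: measurable_itv.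
have g0 k t : (0 <= g k t)%E by rewrite lee_fin !mulr_ge0.
have mg k : measurable_fun D (g k).
  apply/measurable_EFinP; apply: measurable_funM => //.
  by apply: measurable_funM => //; apply: measurable_indic; exact: measurable_itv.
have slice t : D t -> ((\prod_(i < m) (b (lift ord0 i) - a (lift ord0 i)))%:E <=
    \sum_(0 <= k <oo) g k t)%E.
  move=> Dt; apply: IH => // [k|x ax]; first by rewrite mulr_ge0.
  pose y i := if unlift ord0 i is Some j then x j else t.
  have [i|k wk cy] := cov y.
    by rewrite /y; case: unliftP => [j ->|->] //; move: Dt; rewrite /D/= in_itv.
  exists k => [|i].
    have := cy ord0; rewrite /y unlift_none => It.
    by rewrite indicE mem_set ?mulr1//= in_itv.
  by have := cy (lift ord0 i); rewrite /y liftK.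
rewrite big_ord_recl mulrC EFinM.
have -> : (b ord0 - a ord0)%:E = lebesgue_measure D.
  rewrite lebesgue_measure_itv/= lte_fin; have := ab ord0.
  rewrite le_eqVlt => /predU1P[->|->]; first by rewrite ltxx subrr.
  by rewrite EFinB.
rewrite -(integral_cst lebesgue_measure mD).
(* The slice inequality is integrated over the first side and sum and integral are exchanged; each
   box then contributes the length of its first side inside [D], at most the full length. *)
apply: (@le_trans _ _ (\int[lebesgue_measure]_(t in D) \sum_(0 <= k <oo) g k t)%E).
  apply: ge0_le_integral => //.
  - by move=> t _; rewrite lee_fin prodr_ge0// => i _; rewrite subr_ge0.
  - by apply: (@ge0_emeasurable_sum _ _ _ _ g xpredT).
rewrite integral_nneseries//; apply: lee_nneseries => [k _ _|k _].
  by apply: integral_ge0.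
rewrite /g; under eq_integral do rewrite mulrAC EFinM.
have mIk : measurable_fun D (fun t => (\1_(Ik k) t : R)%:E).
  by apply/measurable_EFinP; apply: measurable_indic; exact: measurable_itv.
have Ik0 t : D t -> (0 <= (\1_(Ik k) t : R)%:E)%E by rewrite lee_fin.
have -> : (\int[lebesgue_measure]_(t in D) ((w k * vol k)%:E * (\1_(Ik k) t)%:E) =
    (w k * vol k)%:E * \int[lebesgue_measure]_(t in D) (\1_(Ik k) t)%:E)%E.
  by apply: ge0_integralZl_EFin => //; rewrite mulr_ge0.
have mI : measurable (Ik k) by exact: measurable_itv.
have -> : (\int[lebesgue_measure]_(t in D) (\1_(Ik k) t)%:E =
    lebesgue_measure (Ik k `&` D) :> \bar R)%E by exact: integral_indic.
have -> : w k * \prod_(i < m.+1) (d k i - c k i) =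
    w k * vol k * (d k ord0 - c k ord0).
  by rewrite big_ord_recl -/(vol k); ring.
rewrite [leRHS]EFinM lee_pmul// ?lee_fin ?mulr_ge0//.
apply: (@le_trans _ _ (lebesgue_measure (Ik k))).
  by apply: le_measure; rewrite ?inE//; exact: measurableI.
rewrite lebesgue_measure_itv/= lte_fin; have := cd k ord0.
rewrite le_eqVlt => /predU1P[->|->]; first by rewrite ltxx subrr.
by rewrite EFinB.
Qed.

(** The weighted covering estimate with all weights equal to 1. It makes a vanishing Monge-Ampere
    measure incompatible with a full box of slopes. *)
Lemma lebesgue_outer_box_le m (a b : 'rV[R]_m) (A : set 'rV[R]_m) :
  (forall i, a 0 i <= b 0 i) -> box a b `<=` A ->
  ((box_volume a b)%:E <= lebesgue_outer A)%E.
Proof.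
move=> ab bA; apply: le_ereal_inf_tmp => _ [cd [cd_le Acd] <-].
have := @weighted_box_cover m (fun i => a 0 i) (fun i => b 0 i) (fun=> 1)
  (fun k i => (cd k).1 0 i) (fun k i => (cd k).2 0 i) ab (fun=> ler01) cd_le.
under eq_eseriesr do rewrite mul1r; apply => x xab.
have [|k _ xk] := Acd (\row_i x i); first by apply: bA => i; rewrite mxE.
by exists k => // i; have := xk i; rewrite mxE.
Qed.

End outer_measure_box.

(** * Convexity on a strictly convex domain *)

Section topology_eps.
Context (R : realType) (V : normedModType R).
Implicit Types (A K : set V) (f : V -> R) (x y v : V).

Lemma within_continuous_normP A f :
  {within A, continuous f} <-> forall x, A x -> forall e : R, 0 < e ->
    exists2 d : R, 0 < d & forall y, A y -> `|y - x| < d -> `|f y - f x| < e.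
Proof.
split=> [/subspace_continuousP cf x Ax e e0|H].
  have /cvgrPdist_lt/(_ _ e0) := cf x Ax.
  rewrite near_withinE => /nbhs_ballP[d /= d0 H]; exists d => // y Ay yx.
  by rewrite distrC; apply: H => //; rewrite -ball_normE /= distrC.
apply/subspace_continuousP => x Ax; apply/cvgrPdist_lt => e e0.
have [d d0 {}H] := H x Ax e e0; rewrite near_withinE; apply/nbhs_ballP.
exists d => //= y; rewrite -ball_normE /= distrC => yx Ay.
by rewrite distrC; exact: H.
Qed.

Lemma open_norm_ball A x : open A -> A x ->
  exists2 d : R, 0 < d & forall y, `|y - x| < d -> A y.
Proof.
move=> oA Ax; have /nbhs_ballP[d /= d0 H] : nbhs x A by apply: open_nbhs_nbhs.
by exists d => // y yx; apply: H; rewrite -ball_normE /= distrC.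
Qed.

Lemma closure_normP A x :
  closure A x <-> forall e : R, 0 < e -> exists2 y, A y & `|y - x| < e.
Proof.
split=> [clA e e0|H B /nbhs_ballP[e /= e0 eB]].
  have [y [Ay]] := clA _ (nbhsx_ballx x e e0).
  by rewrite -ball_normE /= distrC => yx; exists y.
have [y Ay yx] := H e e0; exists y; split => //.
by apply: eB; rewrite -ball_normE /= distrC.
Qed.

(** The near-covering form of compactness is applied to the filter of radii tending to 0 from the
    right: half of the radius found at [x] serves all points near [x]. *)
Lemma compact_uniform_ball K A : compact K -> open A -> K `<=` A ->
  exists2 r : R, 0 < r & forall x y, K x -> `|y - x| < r -> A y.
Proof.
move=> /compact_near_coveringP cK oA KA.
pose P (r : R) x := forall y, `|y - x| < r -> A y.
have [x Kx|d /= d0 H] := cK R (0^'+) P _.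
  have [d d0 H] := open_norm_ball oA (KA x Kx).
  have d20 : 0 < d / 2 by rewrite divr_gt0.
  exists ([set y | `|y - x| < d / 2], [set r | r < d / 2]) => /=.
    split; last exact: nbhs_right_lt.
    apply/nbhs_ballP; exists (d / 2) => // y.
    by rewrite -ball_normE /= distrC.
  move=> [y r] /= [yx rd] z zy; apply: H.
  have -> : z - x = (z - y) + (y - x) by rewrite addrA subrK.
  by rewrite (le_lt_trans (ler_normD _ _))// [d]splitr ltrD// (lt_trans zy).
exists (d / 2); first by rewrite divr_gt0.
move=> x y Kx; apply: (H (d / 2)) => //=; last by rewrite divr_gt0.
rewrite sub0r normrN gtr0_norm ?divr_gt0//.
by rewrite ltr_pdivrMr// ltr_pMr// ltr1n.
Qed.

Lemma within_continuous_line A f x v (e : R) : {within A, continuous f} ->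
  A x -> 0 < e -> exists2 d : R, 0 < d & forall s : R, 0 < s < d ->
    A (x + s *: v) -> `|f (x + s *: v) - f x| < e.
Proof.
move=> /within_continuous_normP cf Ax e0; have [d d0 H] := cf x Ax e e0.
have v0 : 0 < `|v| + 1 by rewrite ltr_wpDl.
exists (d / (`|v| + 1)); first by rewrite divr_gt0.
move=> s /andP[s0 sd] As; apply: H => //; rewrite addrC addKr normrZ gtr0_norm//.
apply: (@le_lt_trans _ _ (s * (`|v| + 1))); last by rewrite -ltr_pdivlMr.
by rewrite ler_wpM2l ?lerDl// ltW.
Qed.

Lemma closure_line A x v (d : R) : 0 < d ->
  (forall s : R, 0 < s < d -> A (x + s *: v)) -> closure A x.
Proof.
move=> d0 H; apply/closure_normP => e e0.
have v0 : 0 < `|v| + 1 by rewrite ltr_wpDl.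
pose s := Num.min (d / 2) (e / (`|v| + 1)).
have s0 : 0 < s by rewrite lt_min !divr_gt0.
exists (x + s *: v).
  by apply: H; rewrite s0 gt_min ltr_pdivrMr// ltr_pMr// ltr1n.
rewrite addrC addKr normrZ gtr0_norm//.
apply: (@lt_le_trans _ _ (s * (`|v| + 1))).
  by rewrite ltr_pM2l// ltrDl.
by rewrite -ler_pdivlMr// ge_min lexx orbT.
Qed.

(** Passage to the limit [s -> 0] in a first order inequality: if [a < 0], a small enough [s] makes
    [s * k] at most [- a / 2]. *)
Lemma ge0_limit (a k d : R) : 0 < d ->
  (forall s, 0 < s < d -> 0 <= a + s * k) -> 0 <= a.
Proof.
move=> d0 H; rewrite leNgt; apply/negP => a0.
have k0 : 0 < `|k| + 1 by rewrite ltr_wpDl.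
pose s := Num.min (d / 2) (- a / (`|k| + 1) / 2).
have s0 : 0 < s by rewrite lt_min !divr_gt0 ?oppr_gt0.
have sd : s < d.
  by rewrite gt_min ltr_pdivrMr// ltr_pMr// ltr1n.
have := H s; rewrite s0 sd => /(_ isT).
have : s * k <= s * `|k| by rewrite ler_wpM2l ?ler_norm// ltW.
have : s * (`|k| + 1) <= - a / 2.
  have : s <= - a / (`|k| + 1) / 2 by rewrite ge_min lexx orbT.
  rewrite mulrAC ler_pdivlMr// => /le_trans; apply; lra.
lra.
Qed.

Lemma within_continuous_line_ge A f x v (a k d : R) : {within A, continuous f} ->
  A x -> 0 < d ->
  (forall s : R, 0 < s < d -> A (x + s *: v) /\ a + s * k <= f (x + s *: v)) ->
  a <= f x.
Proof.
move=> cf Ax d0 H; rewrite -subr_ge0.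
apply/ler_addgt0Pr => e e0.
have [d' d'0 Hc] := within_continuous_line v cf Ax e0.
apply: (@ge0_limit _ (- k) (Num.min d d')).
  by rewrite lt_min d0.
move=> s /andP[s0]; rewrite lt_min => /andP[sd sd'].
have [|As le] := H s; first by rewrite s0.
have := Hc s; rewrite s0 sd' => /(_ isT As); rewrite ltr_norml => /andP[_].
lra.
Qed.

End topology_eps.

Lemma within_continuous_comp_sub (T S X : topologicalType) (A : set T)
    (B : set S) (w : T -> S) (f : S -> X) : continuous w ->
  (forall y, A y -> B (w y)) -> {within B, continuous f} ->
  {within A, continuous (f \o w)}.
Proof.
move=> cw AB /subspace_continuousP cf; apply/subspace_continuousP => x Ax.
apply: cvg_comp (cf _ (AB _ Ax)) => P; rewrite /= /within /= => PB.
have := cw x _ PB; rewrite /= /nbhs/=; apply: filterS => y /= H Ay.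
exact/H/AB.
Qed.

Lemma affine_map_continuous (R : realType) (V : normedModType R) (a b : R) (x : V) :
  continuous (fun y : V => b *: (x - a *: y)).
Proof.
move=> y; apply: cvgZl_tmp; apply: cvgB; first exact: cvg_cst.
by apply: cvgZl_tmp; exact: cvg_id.
Qed.

Lemma within_continuous_sub_dotprod (R : realType) m (A : set 'rV[R]_m)
    (f : 'rV[R]_m -> R) q : {within A, continuous f} ->
  {within A, continuous (fun x => f x - dotprod q x)}.
Proof.
move=> cf; apply/within_continuous_normP => w Aw e e0.
have e20 : 0 < e / 2 by rewrite divr_gt0.
have [d d0 Hd] := (within_continuous_normP _ _).1 cf w Aw _ e20.
have k0 : 0 < m%:R * `|q| + 1 by rewrite ltr_wpDl// mulr_ge0.
exists (Num.min d (e / 2 / (m%:R * `|q| + 1))); first by rewrite lt_min d0 divr_gt0.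
move=> y Ay; rewrite lt_min => /andP[yd yd'].
have -> : f y - dotprod q y - (f w - dotprod q w) =
    (f y - f w) - dotprod q (y - w) by rewrite dotprodBr; ring.
rewrite (le_lt_trans (ler_normB _ _))// [e]splitr ltrD ?Hd//.
rewrite (le_lt_trans (norm_dotprod _ _))//.
apply: (@le_lt_trans _ _ ((m%:R * `|q| + 1) * `|y - w|)).
  by rewrite ler_wpM2r// lerDl.
by rewrite mulrC -ltr_pdivlMr.
Qed.

(** * Strictly convex domains and the pinched functions on them *)

Section strictly_convex_domain.
Context (R : realType) (n : nat) (U : set 'rV[R]_n).
Hypotheses (oU : open U) (bU : bounded_set U) (sU : strictly_convex U).
Implicit Types (x y : 'rV[R]_n) (s : R).

Lemma segmentE s x y : (1 - s) *: x + s *: y = x + s *: (y - x).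
Proof. by rewrite scalerBl scale1r scalerBr -addrA [_ + s *: y]addrC. Qed.

Lemma open_segment x y s : closure U x -> closure U y -> x != y ->
  0 < s < 1 -> U (x + s *: (y - x)).
Proof. by rewrite -segmentE; exact: sU. Qed.

Lemma domain_convex x y s : U x -> U y -> 0 <= s <= 1 -> U (x + s *: (y - x)).
Proof.
move=> Ux Uy /andP[s0 s1].
have [->|xy] := eqVneq x y; first by rewrite subrr scaler0 addr0.
move: s0 s1; rewrite !le_eqVlt => /predU1P[<-|s0]; first by rewrite scale0r addr0.
move=> /predU1P[->|s1]; first by rewrite scale1r addrC subrK.
by apply: open_segment => //; [exact: subset_closure..|rewrite s0].
Qed.

Lemma closure_convex x y s : closure U x -> closure U y -> 0 <= s <= 1 ->
  closure U (x + s *: (y - x)).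
Proof.
move=> Ux Uy /andP[s0 s1].
have [->|xy] := eqVneq x y; first by rewrite subrr scaler0 addr0.
move: s0 s1; rewrite !le_eqVlt => /predU1P[<-|s0]; first by rewrite scale0r addr0.
move=> /predU1P[->|s1]; first by rewrite scale1r addrC subrK.
by apply: subset_closure; apply: open_segment => //; rewrite s0.
Qed.

Lemma closureD_boundary x : closure U x -> ~ U x -> boundary U x.
Proof. by move=> clx Ux; split => // /interior_subset. Qed.

Lemma closure_norm_le : exists2 M : R, 0 <= M & forall x, closure U x -> `|x| <= M.
Proof.
have [M M0 UM] := ex_strict_bound_gt0 bU.
exists M => [|x]; first exact: ltW.
move=> /closure_normP clx; apply/ler_addgt0Pr => e e0.
have [y Uy yx] := clx e e0; have -> : x = y + (x - y) by rewrite addrC subrK.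
apply: le_trans (ler_normD _ _) _; apply: lerD; first exact/ltW/UM.
by rewrite distrC ltW.
Qed.

Lemma compact_closure_domain : compact (closure U).
Proof.
apply: bounded_closed_compact; last exact: closed_closure.
have [M M0 clM] := closure_norm_le; exists M; split; first exact: num_real.
by move=> M' MM' x clx; apply: le_trans (clM x clx) (ltW MM').
Qed.

Section pinched_function.
Context (f : 'rV[R]_n -> R) (C L : R).
Hypotheses (cf : {within closure U, continuous f})
  (f0 : forall x, boundary U x -> f x = 0) (pf : pinched U f C L).

Lemma pinched_le x y : U x -> U y ->
  f x + dotprod (grad f x) (y - x) <= f y <=
  f x + dotprod (grad f x) (y - x) + C * `|y - x| ^+ 2.
Proof.
move=> Ux Uy; have [<-|xy] := eqVneq x y.
  by rewrite subrr dotprod0r normr0 expr0n mulr0 !addr0 lexx.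
by have /andP[/ltW -> ->] := pf.2 _ _ Ux Uy xy.
Qed.

(** The inequality known in [U] reaches the closure by continuity along the segment from [y] to [x],
    which is interior by strict convexity. *)
Lemma pinched_support x y : U x -> closure U y ->
  f x + dotprod (grad f x) (y - x) <= f y.
Proof.
move=> Ux cly; have [->|yx] := eqVneq y x; first by rewrite subrr dotprod0r addr0.
apply: (@within_continuous_line_ge _ _ _ _ y (x - y) _
  (- dotprod (grad f x) (y - x)) 1 cf) => // s s01.
have Uys : U (y + s *: (x - y)).
  by apply: open_segment => //; exact: subset_closure.
split; first exact: subset_closure.
have /andP[+ _] := pinched_le Ux Uys; apply: le_trans.
have -> : y + s *: (x - y) - x = (1 - s) *: (y - x).
  by rewrite addrAC -[x - y]opprB scalerN scalerBl scale1r.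
by rewrite dotprodZr; lra.
Qed.

Lemma pinched_support_lt x y : U x -> closure U y -> x != y ->
  f x + dotprod (grad f x) (y - x) < f y.
Proof.
move=> Ux cly xy.
(* Strictness is available between points of [U], so it is used from [x] to the midpoint; the
   hyperplane at the midpoint, tested at both ends, transfers it to [y]. *)
pose z := x + 2^-1 *: (y - x).
have Uz : U z.
  by apply: open_segment => //; [exact: subset_closure|rewrite invr_gt0 invf_lt1 ?ltr1n ?ltr0n].
have zx : x != z.
  rewrite -subr_eq0 opprD addrA subrr add0r oppr_eq0 scaler_eq0 invr_eq0.
  by rewrite pnatr_eq0/= subr_eq0 eq_sym.
have [_ /(_ x z Ux Uz zx)/andP[lt1 _]] := pf.
have le1 := pinched_support Uz cly.
have le2 := pinched_support Uz (subset_closure Ux).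
have Ezx : z - x = 2^-1 *: (y - x) by rewrite addrC addKr.
have Exz : x - z = - 2^-1 *: (y - x) by rewrite -opprB Ezx scaleNr.
have Eyz : y - z = 2^-1 *: (y - x).
  have -> : y - z = (y - x) - (z - x) by rewrite opprB addrA subrK.
  rewrite Ezx -{1}[y - x]scale1r -scalerBl; congr (_ *: _); lra.
move: lt1 le1 le2; rewrite Ezx Exz Eyz !dotprodZr; lra.
Qed.

(** No interior point is a maximum: a step along a coordinate axis, in the sense in which the
    derivative is nonnegative, strictly increases [f]. Hence the maximum over the closure is the
    boundary value 0, and it is not attained inside. *)
Lemma pinched_lt0 x : (0 < n)%N -> U x -> f x < 0.
Proof.
move=> n0 Ux.
have Ucl := @subset_closure _ U.
have [z clz fz] := compact_EVT_max (ex_intro _ x (Ucl _ Ux))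
  compact_closure_domain cf.
rewrite inE in clz.
have fzx y : U y -> exists2 y', U y' & f y < f y'.
  move=> Uy; have [d d0 H] := open_norm_ball oU Uy.
  pose e : 'rV[R]_n := delta_mx 0 (Ordinal n0).
  have e0 : e != 0.
    apply/eqP => /rowP /(_ (Ordinal n0)); rewrite !mxE !eqxx => /eqP.
    by rewrite oner_eq0.
  have d20 : 0 < d / 2 by rewrite divr_gt0.
  have Ud (a : R) : `|a| = d / 2 -> U (y + a *: e).
    move=> ad; apply: H; rewrite addrC addKr normrZ ad.
    apply: (@le_lt_trans _ _ (d / 2)); last by lra.
    by rewrite ler_piMr ?norm_delta// ltW.
  have yd (a : R) : a != 0 -> y != y + a *: e.
    by move=> a0; rewrite -{1}[y]addr0 (inj_eq (addrI y)) eq_sym scaler_eq0 negb_or a0.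
  have lt_f (a : R) : `|a| = d / 2 -> a != 0 ->
      f y + a * dotprod (grad f y) e < f (y + a *: e).
    move=> ad a0; have [_ /(_ y _ Uy (Ud a ad) (yd a a0))/andP[+ _]] := pf.
    by rewrite [y + a *: e - y]addrC addKr dotprodZr.
  have [ge0|lt0] := leP 0 (dotprod (grad f y) e).
    exists (y + (d / 2) *: e); first by apply: Ud; rewrite gtr0_norm.
    apply: le_lt_trans (lt_f _ _ _); rewrite ?gtr0_norm ?gt_eqF//.
    by rewrite lerDl mulr_ge0// ltW.
  exists (y + (- (d / 2)) *: e); first by apply: Ud; rewrite normrN gtr0_norm.
  apply: le_lt_trans (lt_f _ _ _); rewrite ?normrN ?gtr0_norm ?oppr_eq0 ?gt_eqF//.
  by rewrite lerDl mulNr -mulrN mulr_ge0 ?oppr_ge0// ltW.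
have Uz : ~ U z.
  move=> /fzx[y Uy]; rewrite ltNge fz// inE; exact: Ucl.
rewrite -(f0 (closureD_boundary clz Uz)).
have [y Uy lt] := fzx _ Ux; apply: lt_le_trans lt _.
by apply: fz; rewrite inE; exact: Ucl.
Qed.

Lemma pinched_convex x y s : closure U x -> closure U y -> 0 <= s <= 1 ->
  f ((1 - s) *: x + s *: y) <= (1 - s) * f x + s * f y.
Proof.
move=> clx cly /andP[s0 s1]; rewrite segmentE.
have [->|xy] := eqVneq x y.
  rewrite subrr scaler0 addr0 le_eqVlt; apply/orP; left; apply/eqP; ring.
move: s0 s1; rewrite !le_eqVlt => /predU1P[<-|s0].
  by rewrite scale0r addr0 subr0 mul1r mul0r addr0 eqxx.
move=> /predU1P[->|s1].
  by rewrite scale1r addrC subrK subrr mul0r mul1r add0r eqxx.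
rewrite -le_eqVlt; set z := x + _.
have Uz : U z by apply: open_segment => //; rewrite s0.
have lex := pinched_support Uz clx.
have ley := pinched_support Uz cly.
have Exz : x - z = - s *: (y - x) by rewrite opprD addrA subrr add0r scaleNr.
have Eyz : y - z = (1 - s) *: (y - x).
  by rewrite scalerBl scale1r -scaleNr -Exz addrA subrK.
move: lex ley; rewrite Exz Eyz !dotprodZr => lex ley.
have := ler_wpM2l (ltW s0) ley.
have := ler_wpM2l (_ : 0 <= 1 - s) lex; rewrite subr_ge0 => /(_ (ltW s1)).
set D := dotprod _ _; move=> h1 h2.
have -> : f z = (1 - s) * (f z + - s * D) + s * (f z + (1 - s) * D) by ring.
exact: lerD.
Qed.

(** As [f] vanishes on the boundary, the sublevel set is a compact subset of [U]. *)
Lemma sublevel_uniform_ball (eta : R) : 0 < eta ->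
  exists2 r : R, 0 < r & forall x y, closure U x -> f x <= - eta ->
    `|y - x| < r -> U y.
Proof.
move=> eta0.
have [|x [/= clx fx]|r r0 H] :=
    @compact_uniform_ball _ _ [set x | closure U x /\ f x <= - eta] U _ oU.
- apply: subclosed_compact compact_closure_domain _; last by move=> x [].
  move=> x /closure_normP clx.
  have cxU : closure U x.
    apply/closure_normP => e e0; have e20 : 0 < e / 2 by rewrite divr_gt0.
    have [y [/closure_normP cly _] yx] := clx _ e20.
    have [z Uz zy] := cly _ e20; exists z => //.
    have -> : z - x = (z - y) + (y - x) by rewrite addrA subrK.
    by rewrite (le_lt_trans (ler_normD _ _))// [e]splitr ltrD.
  split=> //.
  apply/ler_addgt0Pr => e e0.
  have [d d0 H] := (within_continuous_normP _ _).1 cf x cxU e e0.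
  have [y [cly fy] yx] := clx _ d0; have := H y cly yx.
  by rewrite ltr_norml => /andP[+ _]; lra.
- apply: contrapT => /(closureD_boundary clx)/f0; lra.
by exists r => // x y clx fx; apply: H.
Qed.

End pinched_function.

(** * The minimum problem for pairs of endpoints *)

Section minimizers.
Context (f g : 'rV[R]_n -> R) (a b : R).
Hypotheses (cf : {within closure U, continuous f})
  (cg : {within closure U, continuous g}) (a0 : 0 < a) (b0 : 0 < b)
  (ab1 : a + b = 1).

Lemma exists_minimizers x : U x ->
  exists x0 x1, [/\ closure U x0, closure U x1, x = a *: x0 + b *: x1 &
    forall y0 y1, closure U y0 -> closure U y1 -> x = a *: y0 + b *: y1 ->
      a * f x0 + b * g x1 <= a * f y0 + b * g y1].
Proof.
(* The constraint determines the second point from the first, so a single variable ranges over a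
   compact set. *)
move=> Ux; pose w y := b^-1 *: (x - a *: y).
have wE y : a *: y + b *: w y = x.
  by rewrite scalerA divff ?gt_eqF// scale1r addrC subrK.
have wE' y y' : x = a *: y + b *: y' -> y' = w y.
  by move=> E; rewrite /w E addrC addKr scalerA mulVf ?gt_eqF// scale1r.
have cw : continuous w by exact: affine_map_continuous.
pose K := closure U `&` w @^-1` closure U.
have cK : compact K.
  apply: (subclosed_compact _ compact_closure_domain); last by move=> y [].
  apply: closedI; first exact: closed_closure.
  by apply: (continuous_closedP _).1 => //; exact: closed_closure.
have Kx : K x.
  split; first exact: subset_closure.
  rewrite /= -(wE' x x); first exact: subset_closure.
  by rewrite -scalerDl ab1 scale1r.
have cF : {within K, continuous (fun y => a * f y + b * (g \o w) y)}.
  have cfK : {within K, continuous (f \o id)}.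
    by apply: (within_continuous_comp_sub _ _ cf) => [y|y []//]; exact: cvg_id.
  have cgK : {within K, continuous (g \o w)}.
    by apply: (within_continuous_comp_sub _ _ cg) => // y [].
  by move=> y; apply: cvgD; apply: cvgMl_tmp; [exact: cfK|exact: cgK].
have [y0 + miny] := compact_EVT_min (ex_intro _ x Kx) cK cF.
rewrite inE => -[cy0 cwy0].
exists y0, (w y0); split => // z0 z1 cz0 cz1 Ez.
have Kz0 : K z0 by split; [exact: cz0|rewrite /= -(wE' _ _ Ez)].
by move: (miny z0 (mem_set Kz0)); rewrite /= -(wE' _ _ Ez).
Qed.

Context (C L C' L' : R).
Hypotheses (pf : pinched U f C L) (pg : pinched U g C' L').

(* First order optimality: moving [x0] along a chord and compensating with
   [x1], around which there is room, can only increase the sum. *)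
Lemma minimizer_support x0 x1 : closure U x0 -> U x1 ->
  (forall y0 y1, closure U y0 -> closure U y1 ->
     a *: x0 + b *: x1 = a *: y0 + b *: y1 ->
     a * f x0 + b * g x1 <= a * f y0 + b * g y1) ->
  forall y, closure U y -> f x0 + dotprod (grad g x1) (y - x0) <= f y.
Proof.
move=> cx0 Ux1 minx y cy.
(* The compensation [k] solves [a * s = b * (s * k)], which keeps the weighted sum fixed. Convexity
   bounds the change of [f] linearly in [s], [g] adds an error of order [s ^ 2], and the limit is
   taken after division by [s]. *)
pose k := a / b; pose h := y - x0; pose D := dotprod (grad g x1) h.
have [d d0 Ud] := open_norm_ball oU Ux1.
have kh0 : 0 < k * `|h| + 1.
  by rewrite ltr_wpDl// mulr_ge0// divr_ge0// ltW.
have : 0 <= a * (f y - f x0 - D).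
  apply: (@ge0_limit _ _ (b * C' * k ^+ 2 * `|h| ^+ 2)
    (Num.min 1 (d / (k * `|h| + 1)))); first by rewrite lt_min ltr01 divr_gt0.
  move=> s /andP[s0]; rewrite lt_min => /andP[s1 sd].
  pose y0 := x0 + s *: h; pose y1 := x1 + (- (s * k)) *: h.
  have cy0 : closure U y0 by apply: closure_convex => //; rewrite !ltW.
  have Ey1 : y1 - x1 = (- (s * k)) *: h by rewrite addrC addKr.
  have ny1 : `|y1 - x1| = s * k * `|h|.
    by rewrite Ey1 normrZ normrN ger0_norm// mulr_ge0 ?divr_ge0// ltW.
  have Uy1 : U y1.
    apply: Ud; rewrite ny1 -mulrA; apply: (@le_lt_trans _ _ (s * (k * `|h| + 1))).
      by rewrite ler_wpM2l ?lerDl// ltW.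
    by rewrite -ltr_pdivlMr.
  have := minx y0 y1 cy0 (subset_closure Uy1).
  have -> : a *: x0 + b *: x1 = a *: y0 + b *: y1.
    rewrite /y0 /y1 (scalerDr a x0) (scalerDr b x1) !scalerA mulrN addrACA.
    rewrite -scalerDl.
    have -> : a * s + - (b * (s * k)) = 0 by rewrite /k; field; rewrite gt_eqF.
    by rewrite scale0r addr0.
  move=> /(_ erefl) lemin.
  have lef : f y0 <= (1 - s) * f x0 + s * f y.
    by rewrite /y0 -segmentE; apply: (pinched_convex cf pf) => //; rewrite !ltW.
  have /andP[_] := pinched_le pg Ux1 Uy1.
  rewrite ny1 Ey1 dotprodZr -/D => leg.
  have a_lef := ler_wpM2l (ltW a0) lef.
  have b_leg := ler_wpM2l (ltW b0) leg.
  have := le_trans lemin (lerD a_lef b_leg).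
  rewrite -subr_ge0.
  have -> : a * ((1 - s) * f x0 + s * f y) + b * (g x1 + - (s * k) * D +
      C' * (s * k * `|h|) ^+ 2) - (a * f x0 + b * g x1) =
    s * (a * (f y - f x0 - D) + s * (b * C' * k ^+ 2 * `|h| ^+ 2)).
    by rewrite /k; field; rewrite gt_eqF.
  by rewrite pmulr_rge0.
by rewrite pmulr_rge0// -/h -/D; lra.
Qed.

End minimizers.

(** * Points with a prescribed subgradient *)

Section subgradients.
Context (f : 'rV[R]_n -> R) (C L : R).
Hypotheses (cf : {within closure U, continuous f}) (pf : pinched U f C L).

Lemma exists_subgradient_point p : U !=set0 -> exists2 x, closure U x &
  forall y, closure U y -> f x + dotprod p (y - x) <= f y.
Proof.
move=> [x0 Ux0]; have [x + minx] := compact_EVT_min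
  (ex_intro _ x0 (subset_closure Ux0)) compact_closure_domain
  (within_continuous_sub_dotprod (q := p) cf).
rewrite inE => cx; exists x => // y cy.
by have := minx y (mem_set cy); rewrite /= dotprodBr; lra.
Qed.

Lemma subgradient_point_unique x y : closure U x -> U y ->
  (forall z, closure U z -> f x + dotprod (grad f y) (z - x) <= f z) -> x = y.
Proof.
move=> cx Uy sub; apply/eqP; rewrite eq_sym; apply/negPn/negP => yx.
have := pinched_support_lt cf pf Uy cx yx.
by have := sub y (subset_closure Uy); rewrite !dotprodBr; lra.
Qed.

(** By compactness the supporting hyperplane at [x] stays below [f] by a fixed [delta] on the
    boundary. A tilt that costs less than this gap keeps the minimizer of [f] minus the tilted
    linear form off the boundary. *)
Lemma subgradient_image_dilation x : U x -> exists e x',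
  [/\ 0 < e, U x' & forall y, closure U y ->
    f x' + dotprod ((1 + e) *: grad f x) (y - x') <= f y].
Proof.
move=> Ux; set p := grad f x; have [M M0 HM] := closure_norm_le.
have [delta delta0 Hd] : exists2 delta : R, 0 < delta &
    forall y, closure U y -> ~ U y -> f x + dotprod p (y - x) + delta <= f y.
  pose B := closure U `&` ~` U.
  have [B0|B0] := pselect (B !=set0); last first.
    by exists 1 => // y cy Uy; exfalso; apply: B0; exists y.
  have cB : compact B.
    apply: (subclosed_compact _ compact_closure_domain); last by move=> y [].
    by apply: closedI; [exact: closed_closure|exact: open_closedC].
  have cfB : {within B, continuous (fun y => f y - dotprod p y)}.
    apply: within_continuous_sub_dotprod.
    have cfB : {within B, continuous (f \o id)}.
      by apply: (within_continuous_comp_sub _ _ cf) => [y|y []//]; exact: cvg_id.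
    exact: cfB.
  have [b + minb] := compact_EVT_min B0 cB cfB; rewrite inE => -[cb nUb].
  have xb : x != b by apply/eqP => xb; apply: nUb; rewrite -xb.
  exists (f b - (f x + dotprod p (b - x))).
    by rewrite subr_gt0; exact: (pinched_support_lt cf pf Ux cb xb).
  move=> y cy Uy; have := minb y (mem_set (conj cy Uy)).
  by rewrite /= !dotprodBr; lra.
(* [k] exceeds all values of [dotprod p (y - x)] for [y] in the closure, so tilting by the factor
   [delta / k] costs less than [delta]. *)
pose k := n%:R * `|p| * (M + M) + 1.
have nk : 0 <= n%:R * `|p| * (M + M) by rewrite !mulr_ge0// addr_ge0.
have k0 : 0 < k by rewrite ltr_wpDl.
have e0 : 0 < delta / k by rewrite divr_gt0.
have [x' cx' sub] := exists_subgradient_point ((1 + delta / k) *: p)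
  (ex_intro _ x Ux).
exists (delta / k), x'; split => //.
apply: contrapT => nUx'; have gap := Hd x' cx' nUx'.
have := sub x (subset_closure Ux).
have : dotprod p (x' - x) <= n%:R * `|p| * (M + M).
  rewrite (le_trans (ler_norm _))// (le_trans (norm_dotprod _ _))//.
  rewrite ler_wpM2l ?mulr_ge0// (le_trans (ler_normB _ _))// lerD ?HM//.
  exact: subset_closure.
move/(ler_wpM2l (ltW e0)).
have : delta / k * (n%:R * `|p| * (M + M)) < delta.
  by rewrite mulrAC ltr_pdivrMr// ltr_pM2l// ltrDl.
rewrite dotprodZl -[x - x']opprB dotprodNr; move: gap.
move: (dotprod p (x' - x)) (delta / k) => D e; lra.
Qed.

End subgradients.

End strictly_convex_domain.

(** * Differentiability and Lipschitz gradients from touching paraboloids *)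

Section touching.
Context (R : realType) (m : nat).
Implicit Types (f : 'rV[R]_m -> R) (z w q : 'rV[R]_m) (O : set 'rV[R]_m).

(** The quadratic term is [o(h)], so the linear form [dotprod q] is the differential. *)
Lemma touching_differentiable f z q (K r : R) : 0 < r ->
  (forall w, `|w - z| < r -> f z + dotprod q (w - z) <= f w <=
    f z + dotprod q (w - z) + K * `|w - z| ^+ 2) ->
  differentiable f z /\ grad f z = q.
Proof.
move=> r0 H.
have lin : linear (dotprod q : 'rV[R]_m -> R^o).
  by move=> a x y; rewrite dotprodDr dotprodZr.
pose linM := GRing.isLinear.Build R 'rV[R]_m R^o *:%R (dotprod q) lin.
pose df : {linear 'rV[R]_m -> R^o} := HB.pack (dotprod q : 'rV[R]_m -> R^o) linM.
have cdf : continuous df.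
  apply: bounded_linear_continuous; apply/linear_boundedP.
  exists (m%:R * `|q|); split; first exact: num_real.
  move=> k qk x; apply: le_trans (norm_dotprod q x) _.
  by rewrite ler_wpM2r// ltW.
have expansion : (f : 'rV[R]_m -> R^o) \o shift z =
    cst (f z : R^o) + df +o_ (0 : 'rV[R]_m) id.
  apply/eqaddoP => e e0; near=> h.
  rewrite /= -[(_ - _) h]/(f (h + z) - (f z + dotprod q h)).
  have hr : `|h + z - z| < r.
    rewrite addrK; near: h; apply/nbhs_ballP; exists r => //= y.
    by rewrite -ball_normE /= sub0r normrN.
  have := H _ hr; rewrite addrK => /andP[lo up].
  have hK : K * `|h| ^+ 2 <= e * `|h|.
    rewrite expr2 mulrA ler_wpM2r//.
    apply: le_trans (ler_wpM2r _ (ler_norm K)) _ => //.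
    have K0 : 0 < `|K| + 1 by rewrite ltr_wpDl.
    apply: (@le_trans _ _ ((`|K| + 1) * `|h|)); first by rewrite ler_wpM2r// lerDl.
    rewrite mulrC -ler_pdivlMr//; near: h; apply/nbhs_ballP.
    exists (e / (`|K| + 1)) => /=; first by rewrite divr_gt0.
    by move=> y; rewrite -ball_normE /= sub0r normrN => /ltW.
  rewrite ger0_norm; last by rewrite subr_ge0.
  by move: up hK; lra.
have dfz := diff_unique cdf expansion.
have difff : differentiable f z by apply/diff_locallyP; rewrite dfz.
split => //; apply/rowP => i; rewrite mxE /partial deriveE// dfz.
exact: dotprod_delta.
Unshelve. all: by end_near. Qed.

(** The two constants are kept apart because the Lipschitz estimates depend on [K] alone, while [r]
    may vary from point to point and degenerate near the boundary. *)
Definition touching O f z q (K r : R) : Prop :=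
  (forall w, O w -> f z + dotprod q (w - z) <= f w) /\
  (forall w, O w -> `|w - z| < r ->
    f w <= f z + dotprod q (w - z) + K * `|w - z| ^+ 2).

(** Let [d] be the norm of [w - z]. At the points [w + y] with [y] of norm at most [d], the
    hyperplane of slope [q'] through [w] lies below the paraboloid at [z], while [f w] lies above
    the hyperplane of slope [q]. Hence [(q' - q) . y] is at most [K (2 d)^2], and the choices of [y]
    equal to plus or minus [d] times a basis vector bound each coordinate by [4 K d]. *)
Lemma touching_subgradient_lipschitz O f z w q q' (K r : R) : 0 <= K ->
  touching O f z q K r ->
  (forall y, O y -> f w + dotprod q' (y - w) <= f y) ->
  (forall y, `|y - w| <= `|w - z| -> O y) -> w != z -> 2 * `|w - z| < r ->
  `|q' - q| <= 4 * K * `|w - z|.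
Proof.
move=> K0 [lo up] lo' Ow wz wr.
pose d := `|w - z|.
have key y : `|y| <= d -> dotprod (q' - q) y <= 4 * K * d * d.
  move=> yd; have Oy : O (w + y) by apply: Ow; rewrite addrC addKr.
  have nd : `|w + y - z| <= 2 * d.
    rewrite addrAC mulr_natl mulr2n (le_trans (ler_normD _ _))// lerD//.
  have h1 := up _ Oy (le_lt_trans nd wr).
  have h2 := lo' _ Oy.
  have h3 := lo w (Ow w _); rewrite subrr normr0 normr_ge0 in h3.
  have h4 : K * `|w + y - z| ^+ 2 <= K * (2 * d) ^+ 2.
    by rewrite ler_wpM2l// !expr2 ler_pM.
  have E1 : w + y - w = y by rewrite addrC addKr.
  have E2 : w + y - z = (w - z) + y by rewrite addrAC.
  rewrite E1 in h2; rewrite {1}E2 dotprodDr in h1.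
  move: h1 h2 (h3 isT) h4; rewrite dotprodBl; lra.
apply: norm_le_coord => [|i]; first by rewrite !mulr_ge0.
have d0 : 0 < d by rewrite normr_gt0 subr_eq0.
have nde (a : R) : `|a| = d -> `|a *: delta_mx 0 i : 'rV[R]_m| <= d.
  by move=> ad; rewrite normrZ ad ler_piMr ?norm_delta// ltW.
have := key _ (nde d (gtr0_norm d0)).
have nd : `|- d| = d by rewrite normrN gtr0_norm.
have := key _ (nde (- d) nd).
rewrite !dotprodZr !dotprod_delta ler_norml -/d => h1 h2.
by apply/andP; split; rewrite -(ler_pM2l d0); move: h1 h2; lra.
Qed.

Lemma touching_grad O f z q (K r : R) : open O -> O z -> 0 < r ->
  touching O f z q K r -> differentiable f z /\ grad f z = q.
Proof.
move=> oO Oz r0 [lo up]; have [d d0 Hd] := open_norm_ball oO Oz.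
apply: (@touching_differentiable _ _ _ K (Num.min r d)).
  by rewrite lt_min r0.
move=> w; rewrite lt_min => /andP[wr /Hd Ow].
by rewrite lo// up.
Qed.

(** Along [e] and [- e] the first order terms dominate the quadratic upper bound at [x], so the
    slopes must agree. *)
Lemma subgradient_unique O f x p (C L : R) : open O -> O x -> pinched O f C L ->
  (forall y, O y -> f x + dotprod p (y - x) <= f y) -> p = grad f x.
Proof.
move=> oO Ox pf sub; have [d d0 Hd] := open_norm_ball oO Ox.
have key (e : 'rV[R]_m) : `|e| <= 1 -> 0 <= dotprod (grad f x - p) e.
  move=> e1; apply: (@ge0_limit _ _ (C * `|e| ^+ 2) d d0) => s /andP[s0 sd].
  have Oy : O (x + s *: e).
    apply: Hd; rewrite addrC addKr normrZ gtr0_norm//.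
    by rewrite (le_lt_trans _ sd)// ler_piMr// ltW.
  have := sub _ Oy; have /andP[_] := pinched_le pf Ox Oy.
  have -> : x + s *: e - x = s *: e by rewrite addrC addKr.
  rewrite !dotprodZr normrZ (gtr0_norm s0) dotprodBl => h1 h2.
  by rewrite -(pmulr_rge0 _ s0); move: h1 h2; lra.
apply/rowP => i; have := key _ (norm_delta R i).
have /key : `|- delta_mx 0 i : 'rV[R]_m| <= 1 by rewrite normrN norm_delta.
rewrite dotprodNr dotprod_delta !mxE => h1 h2.
by apply/eqP; rewrite eq_le; apply/andP; split; lra.
Qed.

End touching.

(** The radius [d] depends on [s] without a uniform lower bound, so the interval cannot be
    subdivided at once. The supremum [c] of the parameters satisfying the bound from 0 satisfies it
    too, and the local estimate at [c] would reach beyond [c] if [c < 1]. *)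
Lemma pointwise_lipschitz (R : realType) (g : R -> R) (k : R) :
  (forall s, 0 <= s <= 1 -> exists2 d, 0 < d & forall s', 0 <= s' <= 1 ->
    `|s' - s| < d -> `|g s' - g s| <= k * `|s' - s|) ->
  `|g 1 - g 0| <= k.
Proof.
move=> H; pose S := [set s : R | 0 <= s <= 1 /\ `|g s - g 0| <= k * s].
have S0 : S 0 by split; [rewrite lexx ler01|rewrite subrr normr0 mulr0].
have supS : has_sup S.
  by split; [exists 0|exists 1 => s [/andP[]]].
pose c := sup S.
have c0 : 0 <= c by apply: sup_upper_bound.
have c1 : c <= 1 by apply: sup_le_ub; [exists 0|move=> s [/andP[]]].
have [d d0 Hd] := H c (introT andP (conj c0 c1)).
have [s [/andP[s0 s1] Ss] sc] := sup_adherent d0 supS.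
have lesc : s <= c by apply: sup_upper_bound => //; split => //; rewrite s0.
have Sc : `|g c - g 0| <= k * c.
  have := Hd s; rewrite s0 s1 distrC ger0_norm ?subr_ge0//.
  rewrite ltrBlDl -ltrBlDr => /(_ isT sc) gs.
  have -> : g c - g 0 = (g s - g 0) - (g s - g c) by ring.
  by rewrite (le_trans (ler_normB _ _))//; move: gs Ss; lra.
move: c1; rewrite le_eqVlt => /predU1P[c1|c1].
  by rewrite -[k]mulr1 -c1.
pose s' := Num.min 1 (c + d / 2).
have cs' : c < s' by rewrite lt_min c1 ltrDl divr_gt0.
have s'd : s' - c < d.
  have : s' <= c + d / 2 by rewrite ge_min lexx orbT.
  lra.
have s'1 : s' <= 1 by rewrite ge_min lexx.
have s'0 : 0 <= s' by rewrite (le_trans c0)// ltW.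
have : s' <= c.
  apply: sup_upper_bound => //; split; first by rewrite s'0.
  have := Hd s'; rewrite s'0 s'1 gtr0_norm ?subr_gt0// => /(_ isT s'd) gs.
  have -> : g s' - g 0 = (g s' - g c) + (g c - g 0) by ring.
  by rewrite (le_trans (ler_normD _ _))//; move: gs Sc; lra.
by rewrite leNgt cs'.
Qed.

Lemma lipschitz_inP (R : realType) (V W : normedModType R) (A : set V)
    (f : V -> W) : [lipschitz f x | x in A] <->
  exists k : R, forall x y, A x -> A y -> `|f x - f y| <= k * `|x - y|.
Proof.
split=> [[k [kreal H]]|[k H]].
  exists (k + 1) => x y Ax Ay; have k1 : k < k + 1 by rewrite ltrDl.
  exact: (H _ k1 (x, y)).
exists k; split; first exact: num_real.
move=> k' kk' [x y] [/= Ax Ay]; apply: le_trans (H x y Ax Ay) _.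
by rewrite ler_wpM2r// ltW.
Qed.

Lemma bounded_in (R : realType) (T : Type) (W : normedModType R) (A : set T)
    (f : T -> W) (k : R) : (forall x, A x -> `|f x| <= k) -> [bounded f x | x in A].
Proof.
move=> H; exists k; split; first exact: num_real.
by move=> k' kk' x Ax; apply: le_trans (H x Ax) (ltW kk').
Qed.

(** * Geodesics *)

Section cylinder.
Context (R : realType) (n : nat).
Implicit Types (x y : 'rV[R]_n) (U : set 'rV[R]_n) (w z : 'rV[R]_(n + 1)).

Definition space_part (w : 'rV[R]_(n + 1)) : 'rV[R]_n := lsubmx w.
Definition time_part (w : 'rV[R]_(n + 1)) : R := rsubmx w 0 0.

Lemma space_xt x (t : R) : space_part (xt x t) = x.
Proof. by rewrite /space_part /xt row_mxKl. Qed.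

Lemma time_xt x (t : R) : time_part (xt x t) = t.
Proof. by rewrite /time_part /xt row_mxKr mxE. Qed.

Lemma xtE w : w = xt (space_part w) (time_part w).
Proof.
rewrite /xt -[LHS]hsubmxK; congr row_mx; apply/rowP => i.
by rewrite [i]ord1 [in RHS]mxE.
Qed.

Lemma xtD x y (t s : R) : xt x t + xt y s = xt (x + y) (t + s).
Proof. by rewrite /xt add_row_mx; congr row_mx; apply/rowP => i; rewrite !mxE. Qed.

Lemma xtZ x (t a : R) : a *: xt x t = xt (a *: x) (a * t).
Proof. by rewrite /xt scale_row_mx; congr row_mx; apply/rowP => i; rewrite !mxE. Qed.

Lemma xtB x y (t s : R) : xt x t - xt y s = xt (x - y) (t - s).
Proof. by rewrite -scaleN1r xtZ xtD scaleN1r mulN1r. Qed.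

Lemma spaceB w z : space_part (w - z) = space_part w - space_part z.
Proof. by rewrite /space_part linearB. Qed.

Lemma timeB w z : time_part (w - z) = time_part w - time_part z.
Proof. by rewrite /time_part linearB !mxE. Qed.

Lemma norm_space w : `|space_part w| <= `|w|.
Proof. by apply: norm_le_coord => // i; rewrite mxE coord_le_norm. Qed.

Lemma norm_time w : `|time_part w| <= `|w|.
Proof. by rewrite /time_part mxE coord_le_norm. Qed.

Lemma norm_xt x (t e : R) : 0 <= e -> `|x| <= e -> `|t| <= e -> `|xt x t| <= e.
Proof.
move=> e0 xe te; apply: norm_le_coord => // i.
rewrite /xt mxE; case: (fintype.split i) => j.
  by rewrite (le_trans (coord_le_norm _ _)).
by rewrite mxE.
Qed.

Lemma dotprod_xt x y (t s : R) : dotprod (xt x t) (xt y s) = dotprod x y + t * s.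
Proof.
rewrite /dotprod big_split_ord /= big_ord1; congr (_ + _).
  by apply: eq_bigr => i _; rewrite /xt !row_mxEl.
by rewrite /xt !row_mxEr !mxE.
Qed.

Lemma cylinderE U w : cylinder U w <-> U (space_part w) /\ 0 < time_part w < 1.
Proof.
split=> [[x Ux [t t01 <-]]|[Uw w01]]; first by rewrite space_xt time_xt.
by exists (space_part w) => //; exists (time_part w) => //; rewrite -xtE.
Qed.

Lemma cylinder_xt U x (t : R) : U x -> 0 < t < 1 -> cylinder U (xt x t).
Proof. by move=> Ux t01; apply/cylinderE; rewrite space_xt time_xt. Qed.

Lemma open_cylinder U : open U -> open (cylinder U).
Proof.
move=> oU; rewrite openE => w /cylinderE[Uw /andP[w0 w1]].
have [d d0 H] := open_norm_ball oU Uw.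
pose r := Num.min d (Num.min (time_part w) (1 - time_part w)).
apply/nbhs_ballP; exists r => /=; first by rewrite !lt_min d0 w0 subr_gt0.
move=> z; rewrite -ball_normE /= distrC !lt_min => /and3P[zd zt zt'].
apply/cylinderE; split.
  by apply: H; rewrite -spaceB (le_lt_trans (norm_space _)).
have := le_lt_trans (norm_time (z - w)) zt.
have := le_lt_trans (norm_time (z - w)) zt'.
rewrite timeB !ltr_norml => /andP[_ ?] /andP[? _]; apply/andP; split; lra.
Qed.

Lemma closure_cylinder U w : closure (cylinder U) w ->
  closure U (space_part w) /\ 0 <= time_part w <= 1.
Proof.
move=> /closure_normP clw; split.
  apply/closure_normP => e e0; have [z /cylinderE[Uz _] zw] := clw e e0.
  by exists (space_part z) => //; rewrite -spaceB (le_lt_trans (norm_space _)).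
have H e : 0 < e -> (0 <= time_part w + e) /\ time_part w <= 1 + e.
  move=> e0; have [z /cylinderE[_ /andP[z0 z1]] zw] := clw e e0.
  have := le_lt_trans (norm_time (z - w)) zw.
  by rewrite timeB ltr_norml => /andP[? ?]; split; lra.
by apply/andP; split; apply/ler_addgt0Pr => e /H[].
Qed.

End cylinder.

(** The points [x0] and [x1] attain the Legendre transforms of [u0] and [u1] over the closure of
    [U], both at the slope [p]. *)
Definition dual_pair (R : realType) (n : nat) (U : set 'rV[R]_n)
    (u0 u1 : 'rV[R]_n -> R) (x0 x1 p : 'rV[R]_n) : Prop :=
  [/\ closure U x0, closure U x1,
      (forall y, closure U y -> u0 x0 + dotprod p (y - x0) <= u0 y) &
      (forall y, closure U y -> u1 x1 + dotprod p (y - x1) <= u1 y)].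

(** * Dual pairs over every interior point *)

Section geodesic.
Context (R : realType) (n : nat) (U : set 'rV[R]_n).
Hypotheses (n_gt0 : (0 < n)%N) (oU : open U) (bU : bounded_set U)
  (sU : strictly_convex U).
Context (u0 u1 : 'rV[R]_n -> R) (C L : R).
Hypotheses (cu0 : {within closure U, continuous u0})
  (cu1 : {within closure U, continuous u1})
  (u0bd : forall x, boundary U x -> u0 x = 0)
  (u1bd : forall x, boundary U x -> u1 x = 0)
  (pu0 : pinched U u0 C L) (pu1 : pinched U u1 C L).

Lemma dual_pair_exists x (t : R) : U x -> 0 < t < 1 -> exists x0 x1 p,
  [/\ dual_pair U u0 u1 x0 x1 p, x = (1 - t) *: x0 + t *: x1 & U x0 \/ U x1].
Proof.
move=> Ux /andP[t0 t1]; have t1' : 0 < 1 - t by rewrite subr_gt0.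
have [x0 [x1 [cx0 cx1 Ex minx]]] :=
  exists_minimizers bU cu0 cu1 t0 (subrK t 1) Ux.
exists x0, x1.
have [Ux1|nUx1] := pselect (U x1).
  exists (grad u1 x1); split=> //; last by right.
  split => // y cy; last exact: (pinched_support sU cu1 pu1).
  apply: (minimizer_support oU sU cu0 t1' t0 pu0 pu1 cx0 Ux1 _ cy) => y0 y1.
  by rewrite -Ex; exact: minx.
have [Ux0|nUx0] := pselect (U x0).
  exists (grad u0 x0); split=> //; last by left.
  split => // y cy; first exact: (pinched_support sU cu0 pu0).
  apply: (minimizer_support oU sU cu1 t0 t1' pu1 pu0 cx1 Ux0 _ cy) => y1 y0.
  rewrite [X in X = _]addrC -Ex addrC [X in X <= _]addrC [X in _ <= X]addrC.
  by move=> cy1 cy0; exact: minx.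
(* With both minimizers on the boundary the minimum would be 0, but the competitor [x0 = x1 = x] has
   a negative value. *)
have lt0 := pinched_lt0 oU bU cu0 u0bd pu0 n_gt0 Ux.
have lt1 := pinched_lt0 oU bU cu1 u1bd pu1 n_gt0 Ux.
have clx := subset_closure Ux.
have := minx x x clx clx; rewrite -scalerDl subrK scale1r => /(_ erefl).
rewrite (u0bd (closureD_boundary cx0 nUx0)) (u1bd (closureD_boundary cx1 nUx1)).
rewrite !mulr0 addr0 leNgt => /negP[].
have : (1 - t) * u0 x < 0 by rewrite pmulr_rlt0.
have : t * u1 x < 0 by rewrite pmulr_rlt0.
by lra.
Qed.

(** * Convexity and boundary values of the geodesic *)

Context (u : 'rV[R]_(n + 1) -> R).
Hypotheses (U_neq0 : U !=set0) (geod_u : weak_geodesic U u0 u1 u).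

Let cu : {within closure (cylinder U), continuous u}.
Proof. by case: geod_u. Qed.

Lemma geodesic_convex w z (s : R) : cylinder U w -> cylinder U z -> 0 <= s <= 1 ->
  u ((1 - s) *: w + s *: z) <= (1 - s) * u w + s * u z.
Proof.
move=> Uw Uz s01; have [_ cvx _ _ _] := geod_u.
case/andP: s01 => s0 s1.
have s0' : 0 <= 1 - s by rewrite subr_ge0.
have s1' : 1 - s <= 1 by rewrite lerBlDr lerDl.
have H : u ((1 - s) *: w + (1 - (1 - s)) *: z) <=
    (1 - s) * u w + (1 - (1 - s)) * u z.
  exact: (cvx (Itv01 s0' s1') w z (mem_set Uw) (mem_set Uz)).
by rewrite subKr in H.
Qed.

Let center := projT1 (cid U_neq0).
Let Ucenter : U center := projT2 (cid U_neq0).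

Lemma closure_toward_center y (s : R) : closure U y -> 0 < s < 1 ->
  U (y + s *: (center - y)).
Proof.
move=> cy s01; have [->|yc] := eqVneq y center.
  by rewrite subrr scaler0 addr0.
exact/(open_segment sU)/s01/yc/subset_closure.
Qed.

Lemma closure_cylinder_xt y (t : R) : closure U y -> 0 <= t <= 1 ->
  closure (cylinder U) (xt y t) /\
  forall s : R, 0 < s < 1 ->
    cylinder U (xt y t + s *: (xt center 2^-1 - xt y t)).
Proof.
move=> cy /andP[t0 t1].
have H s : 0 < s < 1 -> cylinder U (xt y t + s *: (xt center 2^-1 - xt y t)).
  move=> /[dup] s01 /andP[s0 s1]; rewrite xtB xtZ xtD; apply: cylinder_xt.
    exact: closure_toward_center.
  have : 0 <= t * (1 - s) by rewrite mulr_ge0// subr_ge0 ltW.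
  have : 0 <= (1 - t) * (1 - s) by rewrite mulr_ge0// subr_ge0// ltW.
  move=> h1 h2; apply/andP; split; nra.
split => //; apply: (closure_line ltr01) => s s01; exact: H.
Qed.

(** The data at times 0 and 1 are prescribed over [U]; the values above the boundary of [U] follow
    by continuity inside a horizontal slice, along the segment towards [center]. *)
Lemma boundary_value_extends (t : R) (f : 'rV[R]_n -> R) : 0 <= t <= 1 ->
  {within closure U, continuous f} -> (forall y, U y -> u (xt y t) = f y) ->
  forall y, closure U y -> u (xt y t) = f y.
Proof.
move=> t01 cf uf y cy.
apply/eqP; rewrite -subr_eq0 -normr_le0; apply/ler_addgt0Pr => e e0.
rewrite add0r; have e20 : 0 < e / 2 by rewrite divr_gt0.
have [cw _] := closure_cylinder_xt cy t01.
have [d1 d10 H1] := within_continuous_line (xt (center - y) 0) cu cw e20.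
have [d2 d20 H2] := within_continuous_line (center - y) cf cy e20.
have [s [s0 s1 sd1 sd2]] : exists s : R, [/\ 0 < s, s < 1, s < d1 & s < d2].
  pose m := Num.min 1 (Num.min d1 d2).
  have m0 : 0 < m by rewrite !lt_min ltr01 d10.
  have mm : m / 2 < m by rewrite ltr_pdivrMr// ltr_pMr// ltr1n.
  exists (m / 2); split; first by rewrite divr_gt0.
  - by apply: lt_le_trans mm _; rewrite ge_min lexx.
  - by apply: lt_le_trans mm _; rewrite !ge_min lexx orbT.
  - by apply: lt_le_trans mm _; rewrite !ge_min lexx !orbT.
have Us : U (y + s *: (center - y)).
  by apply: closure_toward_center => //; rewrite s0.
have Es : xt y t + s *: xt (center - y) 0 = xt (y + s *: (center - y)) t.
  by rewrite xtZ xtD mulr0 addr0.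
have clUs := subset_closure Us.
have := H2 s; rewrite s0 sd2 => /(_ isT clUs).
have := H1 s; rewrite s0 sd1 Es => /(_ isT (closure_cylinder_xt clUs t01).1).
rewrite uf// !ltr_norml => /andP[? ?] /andP[? ?].
by rewrite ler_norml; apply/andP; split; lra.
Qed.

Lemma geodesic_bottom y : closure U y -> u (xt y 0) = u0 y.
Proof.
apply: boundary_value_extends => // [|z Uz]; first by rewrite lexx ler01.
by have [_ _ _ /(_ z Uz)[]] := geod_u.
Qed.

Lemma geodesic_top y : closure U y -> u (xt y 1) = u1 y.
Proof.
apply: boundary_value_extends => // [|z Uz]; first by rewrite lexx ler01.
by have [_ _ _ /(_ z Uz)[]] := geod_u.
Qed.

(** Convexity is given in the open cylinder, whereas the endpoints lie on its boundary. All three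
    points are drawn by the same factor [s] towards [center] at time 1/2, which preserves the convex
    combination, and continuity absorbs the error for small [s]. *)
Lemma geodesic_le y0 y1 (t : R) : closure U y0 -> closure U y1 -> 0 < t < 1 ->
  u (xt ((1 - t) *: y0 + t *: y1) t) <= (1 - t) * u0 y0 + t * u1 y1.
Proof.
move=> cy0 cy1 t01; case/andP: (t01) => t0 t1.
have t01' : 0 <= t <= 1 by rewrite !ltW.
have i0 : 0 <= (0 : R) <= 1 by rewrite lexx ler01.
have i1 : 0 <= (1 : R) <= 1 by rewrite ler01 lexx.
have cy : closure U ((1 - t) *: y0 + t *: y1).
  by rewrite segmentE; apply: closure_convex.
have [cX HX] := closure_cylinder_xt cy0 i0.
have [cY HY] := closure_cylinder_xt cy1 i1.
have [cZ HZ] := closure_cylinder_xt cy t01'.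
rewrite -(geodesic_bottom cy0) -(geodesic_top cy1).
set X := xt y0 0 in cX HX *; set Y := xt y1 1 in cY HY *.
set Z := xt _ t in cZ HZ *; set M := xt center _ in HX HY HZ.
have EZ s : Z + s *: (M - Z) =
    (1 - t) *: (X + s *: (M - X)) + t *: (Y + s *: (M - Y)).
  have -> : Z = (1 - t) *: X + t *: Y.
    by rewrite /X /Y !xtZ xtD mulr0 mulr1 add0r.
  have {1}-> : M = (1 - t) *: M + t *: M by rewrite -scalerDl subrK scale1r.
  rewrite opprD addrACA -!scalerBr [in LHS]scalerDr !scalerA ![s * _]mulrC.
  by rewrite -!scalerA addrACA -!scalerDr.
apply/ler_addgt0Pr => e e0; have e20 : 0 < e / 2 by rewrite divr_gt0.
have [d0 d00 H0] := within_continuous_line (M - X) cu cX e20.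
have [d1 d10 H1] := within_continuous_line (M - Y) cu cY e20.
have [d d0' H] := within_continuous_line (M - Z) cu cZ e20.
pose m := Num.min 1 (Num.min d (Num.min d0 d1)).
have m0 : 0 < m by rewrite !lt_min ltr01 d0' d00.
have mm : m / 2 < m by rewrite ltr_pdivrMr// ltr_pMr// ltr1n.
pose s := m / 2.
have s0 : 0 < s by rewrite divr_gt0.
have s1 : s < 1 by apply: lt_le_trans mm _; rewrite ge_min lexx.
have sd : s < d by apply: lt_le_trans mm _; rewrite !ge_min lexx orbT.
have sd0 : s < d0 by apply: lt_le_trans mm _; rewrite !ge_min lexx !orbT.
have sd1 : s < d1 by apply: lt_le_trans mm _; rewrite !ge_min lexx !orbT.
have s01 : 0 < s < 1 by rewrite s0.
have := geodesic_convex (HX s s01) (HY s s01) t01'; rewrite -EZ => leZ.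
have := H s; rewrite s0 sd => /(_ isT (subset_closure (HZ s s01))).
have := H0 s; rewrite s0 sd0 => /(_ isT (subset_closure (HX s s01))).
have := H1 s; rewrite s0 sd1 => /(_ isT (subset_closure (HY s s01))).
rewrite !ltr_norml => /andP[_ leY] /andP[_ leX] /andP[geZ _].
have := ler_wpM2l (ltW t0) (ltW leY).
have t1' : 0 <= 1 - t by rewrite subr_ge0 ltW.
have := ler_wpM2l t1' (ltW leX).
nra.
Qed.

(** * Affine minorants and Alexandrov's argument *)

Definition slope (x0 x1 p : 'rV[R]_n) : 'rV[R]_(n + 1) :=
  xt p (u1 x1 - u0 x0 - dotprod p (x1 - x0)).

(** For a dual pair, the time component of [slope] is the Legendre transform of [u0] at [p] minus
    that of [u1]. The function restricts to the supporting hyperplane of [u0] at time 0 and to that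
    of [u1] at time 1. *)
Definition affine_minorant (x0 x1 p : 'rV[R]_n) (w : 'rV[R]_(n + 1)) : R :=
  u0 x0 + dotprod (slope x0 x1 p) (w - xt x0 0).

Lemma affine_minorant_xt x0 x1 p y (s : R) : affine_minorant x0 x1 p (xt y s) =
  (1 - s) * (u0 x0 + dotprod p (y - x0)) + s * (u1 x1 + dotprod p (y - x1)).
Proof.
rewrite /affine_minorant /slope xtB dotprod_xt subr0 !dotprodBr; ring.
Qed.

Lemma affine_minorantB x0 x1 p w z :
  affine_minorant x0 x1 p w =
  affine_minorant x0 x1 p z + dotprod (slope x0 x1 p) (w - z).
Proof. by rewrite /affine_minorant !dotprodBr; ring. Qed.

Lemma affine_minorant_dual x0 x1 p (t : R) :
  affine_minorant x0 x1 p (xt ((1 - t) *: x0 + t *: x1) t) =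
  (1 - t) * u0 x0 + t * u1 x1.
Proof.
by rewrite affine_minorant_xt !dotprodBr !dotprodDr !dotprodZr; ring.
Qed.

(** On the lateral boundary both supporting hyperplanes are at most the common boundary value 0,
    hence so is their interpolation; at the bottom and the top the claim is the support inequality
    itself. *)
Lemma affine_minorant_boundary x0 x1 p (w : 'rV[R]_(n + 1)) : dual_pair U u0 u1 x0 x1 p ->
  closure (cylinder U) w -> ~ cylinder U w -> affine_minorant x0 x1 p w <= u w.
Proof.
move=> [cx0 cx1 sub0 sub1] clw nw.
have [cy /andP[s0 s1]] := closure_cylinder clw.
move: nw; rewrite (xtE w); set y := space_part w in cy *; set s := time_part w in s0 s1 *.
move=> nw; have le0 := sub0 y cy; have le1 := sub1 y cy.
rewrite affine_minorant_xt.
move: s0; rewrite le_eqVlt => /predU1P[s0|s0].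
  by rewrite -s0 geodesic_bottom// subr0 mul1r mul0r addr0.
move: s1; rewrite le_eqVlt => /predU1P[s1|s1].
  by rewrite s1 geodesic_top// subrr mul1r mul0r add0r.
have nUy : ~ U y by move=> Uy; apply: nw; apply: cylinder_xt => //; rewrite s0.
have by_ := closureD_boundary cy nUy.
have [_ _ _ _ ->//] := geod_u; last by rewrite s0.
move: le0 le1; rewrite (u0bd by_) (u1bd by_) => le0 le1.
have h0 := ler_wpM2l (ltW s0) le1.
have := ler_wpM2l (_ : 0 <= 1 - s) le0; rewrite subr_ge0 => /(_ (ltW s1)).
lra.
Qed.

Lemma compact_closure_cylinder : compact (closure (cylinder U)).
Proof.
apply: bounded_closed_compact; last exact: closed_closure.
have [M M0 clM] := closure_norm_le bU; exists (M + 1); split.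
  exact: num_real.
move=> M' MM' w /closure_cylinder[cw /andP[w0 w1]].
apply: le_trans (ltW MM'); rewrite (xtE w); apply: norm_xt.
- by rewrite addr_ge0.
- by rewrite (le_trans (clM _ cw))// lerDl.
- by rewrite ger0_norm// (le_trans w1)// lerDr.
Qed.

(* Alexandrov's argument: if [u] were below the affine function at [z], all
   slopes near that of the affine function would be attained as subgradients
   of [u] in the cylinder, which would then have positive measure. *)
Lemma affine_minorant_le x0 x1 p (z : 'rV[R]_(n + 1)) : dual_pair U u0 u1 x0 x1 p ->
  cylinder U z -> affine_minorant x0 x1 p z <= u z.
Proof.
move=> dp cz; rewrite leNgt; apply/negP => lt.
pose delta := affine_minorant x0 x1 p z - u z.
have delta0 : 0 < delta by rewrite subr_gt0.
have [M M0 HM] : exists2 M : R, 0 < M &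
    forall w : 'rV[R]_(n + 1), closure (cylinder U) w -> `|w - z| <= M.
  have /compact_bounded/ex_strict_bound_gt0[M M0 HM] := compact_closure_cylinder.
  exists (M + M); first by rewrite addr_gt0.
  move=> w clw; rewrite (le_trans (ler_normB _ _))// lerD//.
    by have := HM w clw; apply: ltW.
  by have := HM z (subset_closure cz); apply: ltW.
pose N : R := (n + 1)%:R.
have N0 : 0 < N by rewrite ltr0n addn1.
(* A slope within [r] of [q0] changes the affine function by at most [delta / 2] over the cylinder,
   half of the deficit at [z]. *)
pose r := delta / (2 * N * M).
have r0 : 0 < r by rewrite divr_gt0// !mulr_gt0.
pose q0 := slope x0 x1 p.
pose a : 'rV[R]_(n + 1) := q0 - const_mx r.
pose b : 'rV[R]_(n + 1) := q0 + const_mx r.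
have ab i : a 0 i <= b 0 i by rewrite !mxE; lra.
have sub : box a b `<=` subdiff_image (cylinder U) u (cylinder U).
  move=> q qab.
  have qq0 : `|q - q0| <= r.
    apply: norm_le_coord => [|i]; first exact: ltW.
    have := qab i; rewrite !mxE => /andP[? ?].
    by rewrite ler_norml; apply/andP; split; lra.
  have cF := within_continuous_sub_dotprod (q := q) cu.
  have [w0 + minw] := compact_EVT_min
    (ex_intro _ z (subset_closure cz)) compact_closure_cylinder cF.
  rewrite inE => clw0.
  have cw0 : cylinder U w0.
    (* On the boundary [u] is above the affine function, so [u] minus the linear form [q] would be
       larger at [w0] than at [z] by at least [delta - delta / 2], against minimality. *)
    apply: contrapT => nw0.
    have ge := affine_minorant_boundary dp clw0 nw0.
    have := minw z (mem_set (subset_closure cz)).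
    rewrite /= (affine_minorantB _ _ _ _ z) -/q0 in ge.
    have : dotprod (q - q0) (w0 - z) <= delta / 2.
      rewrite (le_trans (ler_norm _))// (le_trans (norm_dotprod _ _))//.
      apply: (@le_trans _ _ (N * r * M)).
        by rewrite ler_pM ?mulr_ge0// ?ler_wpM2l ?HM// ltW.
      rewrite /r le_eqVlt; apply/orP; left; apply/eqP; field.
      by rewrite !gt_eqF.
    move: ge delta0; rewrite /delta dotprodBl !dotprodBr; lra.
  exists w0 => // y cy.
  have := minw y (mem_set (subset_closure cy)).
  by rewrite /= dotprodBr; lra.
have := lebesgue_outer_box_le ab sub.
have [_ _ alex _ _] := geod_u.
have /alex/(_ (@subset_refl _ _)) : <<s [set O : set 'rV[R]_(n + 1) | open O] >> (cylinder U).
  by apply: sub_sigma_algebra; exact: open_cylinder.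
rewrite /monge_ampere => ->; rewrite lee_fin leNgt => /negP; apply.
by rewrite /box_volume prodr_gt0// => i _; rewrite !mxE; lra.
Qed.

Lemma geodesic_dual x0 x1 p (t : R) : dual_pair U u0 u1 x0 x1 p ->
  0 < t < 1 -> U ((1 - t) *: x0 + t *: x1) ->
  u (xt ((1 - t) *: x0 + t *: x1) t) = (1 - t) * u0 x0 + t * u1 x1.
Proof.
move=> dp t01 Ux; apply/eqP; rewrite eq_le -{2}(affine_minorant_dual _ _ p).
rewrite affine_minorant_le//; last exact: cylinder_xt.
by have [cx0 cx1 _ _] := dp; rewrite geodesic_le.
Qed.

(** * Quadratic upper bounds and the gradient of the geodesic *)

Hypotheses (C_ge0 : 0 <= C) (L_ge0 : 0 <= L).

Lemma dual_pair_grad0 x0 x1 p : dual_pair U u0 u1 x0 x1 p -> U x0 ->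
  p = grad u0 x0.
Proof.
move=> [_ _ sub0 _] Ux0; apply: (subgradient_unique oU Ux0 pu0) => y Uy.
by apply: sub0; exact: subset_closure.
Qed.

Lemma dual_pair_grad1 x0 x1 p : dual_pair U u0 u1 x0 x1 p -> U x1 ->
  p = grad u1 x1.
Proof.
move=> [_ _ _ sub1] Ux1; apply: (subgradient_unique oU Ux1 pu1) => y Uy.
by apply: sub1; exact: subset_closure.
Qed.

(** The moved pair [y0], [y1] is a competitor, and pinching bounds the increase of its value.
    Pinching holds inside [U], so a member of the pair that lies on the boundary has to stay
    fixed. *)
Lemma geodesic_upper x0 x1 p y0 y1 (s : R) : dual_pair U u0 u1 x0 x1 p ->
  0 < s < 1 -> y0 = x0 \/ U x0 /\ U y0 -> y1 = x1 \/ U x1 /\ U y1 ->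
  u (xt ((1 - s) *: y0 + s *: y1) s) <=
  affine_minorant x0 x1 p (xt ((1 - s) *: y0 + s *: y1) s) +
  C * ((1 - s) * `|y0 - x0| ^+ 2 + s * `|y1 - x1| ^+ 2).
Proof.
move=> dp s01 H0 H1; have [cx0 cx1 _ _] := dp.
have [cy0 up0] : closure U y0 /\
    u0 y0 <= u0 x0 + dotprod p (y0 - x0) + C * `|y0 - x0| ^+ 2.
  case: H0 => [->|[Ux0 Uy0]].
    by rewrite subrr dotprod0r normr0 expr0n mulr0 !addr0.
  split; first exact: subset_closure.
  by rewrite (dual_pair_grad0 dp Ux0); case/andP: (pinched_le pu0 Ux0 Uy0).
have [cy1 up1] : closure U y1 /\
    u1 y1 <= u1 x1 + dotprod p (y1 - x1) + C * `|y1 - x1| ^+ 2.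
  case: H1 => [->|[Ux1 Uy1]].
    by rewrite subrr dotprod0r normr0 expr0n mulr0 !addr0.
  split; first exact: subset_closure.
  by rewrite (dual_pair_grad1 dp Ux1); case/andP: (pinched_le pu1 Ux1 Uy1).
apply: le_trans (geodesic_le cy0 cy1 s01) _; case/andP: s01 => s0 s1.
have s1' : 0 <= 1 - s by rewrite subr_ge0 ltW.
have h0 := ler_wpM2l s1' up0; have h1 := ler_wpM2l (ltW s0) up1.
apply: le_trans (lerD h0 h1) _; rewrite affine_minorant_xt.
rewrite !dotprodBr !dotprodDr !dotprodZr le_eqVlt; apply/orP; left; apply/eqP.
by ring.
Qed.

(** The interior member of the pair identifies [p] with a gradient, bounded by [L]; the time
    component is then controlled by the bounds on [u0], [u1] and on the closure of [U]. *)
Lemma slope_bounded : exists2 B : R, 0 <= B & forall x0 x1 p,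
  dual_pair U u0 u1 x0 x1 p -> U x0 \/ U x1 -> `|slope x0 x1 p| <= B.
Proof.
have [M M0 HM] := closure_norm_le bU.
have bound f : {within closure U, continuous f} ->
    exists2 N : R, 0 < N & forall y, closure U y -> `|f y : R| <= N.
  move=> cf.
  have /compact_bounded/ex_strict_bound_gt0[N N0 HN] :=
    continuous_compact cf (compact_closure_domain bU).
  by exists N => // y cy; apply/ltW/HN; exists y.
have [N0 N00 HN0] := bound _ cu0; have [N1 N10 HN1] := bound _ cu1.
have nL : 0 <= n%:R * L * (M + M) by rewrite !mulr_ge0// addr_ge0.
exists (L + (N1 + N0 + n%:R * L * (M + M))).
  by rewrite !addr_ge0// ltW.
move=> x0 x1 p dp Ux; have [cx0 cx1 _ _] := dp.
have pL : `|p| <= L.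
  case: Ux => [Ux|Ux]; first by rewrite (dual_pair_grad0 dp Ux) pu0.1.
  by rewrite (dual_pair_grad1 dp Ux) pu1.1.
have N01 : 0 <= N1 + N0 by rewrite addr_ge0// ltW.
apply: norm_xt; first by rewrite !addr_ge0// ltW.
  by rewrite (le_trans pL)// lerDl addr_ge0.
apply: (@le_trans _ _ (N1 + N0 + n%:R * L * (M + M))); last by rewrite lerDr.
apply: le_trans (ler_normB _ _) _; apply: lerD.
  by apply: le_trans (ler_normB _ _) _; apply: lerD; [exact: HN1|exact: HN0].
apply: le_trans (norm_dotprod _ _) _.
have x10 : `|x1 - x0| <= M + M.
  by apply: le_trans (ler_normB _ _) _; apply: lerD; exact: HM.
by apply: ler_pM; rewrite ?mulr_ge0//; apply: ler_wpM2l.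
Qed.

Lemma geodesic_touch z : cylinder U z -> exists x0 x1 p,
  [/\ dual_pair U u0 u1 x0 x1 p, U x0 \/ U x1,
      z = xt ((1 - time_part z) *: x0 + time_part z *: x1) (time_part z),
      u z = affine_minorant x0 x1 p z &
      forall w, cylinder U w -> u z + dotprod (slope x0 x1 p) (w - z) <= u w].
Proof.
move=> cz; have /cylinderE[Uz t01] := cz.
have [x0 [x1 [p [dp Ez Ux]]]] := dual_pair_exists Uz t01.
exists x0, x1, p.
have Ez' : z = xt ((1 - time_part z) *: x0 + time_part z *: x1) (time_part z).
  by rewrite -Ez -xtE.
have uz : u z = affine_minorant x0 x1 p z.
  rewrite {1}Ez' [in RHS]Ez' affine_minorant_dual; apply: geodesic_dual dp t01 _.
  by rewrite -Ez.
split => // w cw; rewrite uz -affine_minorantB.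
exact: affine_minorant_le.
Qed.

Lemma geodesic_lipschitz_bound : exists2 B : R, 0 <= B &
  forall z w, cylinder U z -> cylinder U w -> `|u z - u w| <= B * `|z - w|.
Proof.
have [B B0 HB] := slope_bounded.
exists ((n + 1)%:R * B); first by rewrite mulr_ge0.
have half z w : cylinder U z -> cylinder U w ->
    u z - u w <= (n + 1)%:R * B * `|z - w|.
  move=> cz cw; have [x0 [x1 [p [dp Ux _ _ sub]]]] := geodesic_touch cz.
  apply: (@le_trans _ _ (- dotprod (slope x0 x1 p) (w - z))).
    by have := sub w cw; lra.
  rewrite -dotprodNr opprB (le_trans (ler_norm _))//.
  apply: le_trans (norm_dotprod _ _) _.
  by rewrite ler_wpM2r// ler_wpM2l// HB.
move=> z w cz cw; rewrite ler_norml half// andbT lerNl opprB distrC.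
exact: half.
Qed.

(* With both minimizers interior, the point [w] is reached by translating both
   of them by the same vector. *)
Lemma interior_touching : exists2 K : R, 0 <= K & forall x0 x1 p z,
  dual_pair U u0 u1 x0 x1 p -> U x0 -> U x1 -> cylinder U z ->
  z = xt ((1 - time_part z) *: x0 + time_part z *: x1) (time_part z) ->
  u z = affine_minorant x0 x1 p z ->
  exists2 r : R, 0 < r & touching (cylinder U) u z (slope x0 x1 p) K r.
Proof.
have [M M0 HM] := closure_norm_le bU.
(* [N] bounds the ratio of the translation [b] to the displacement [w - z]: 1 for the spatial part,
   [M + M] for the change of time along [x1 - x0]. *)
pose N := 1 + (M + M); have N0 : 0 < N by rewrite ltr_pwDl// addr_ge0.
exists (C * N ^+ 2); first by rewrite mulr_ge0// exprn_ge0// ltW.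
move=> x0 x1 p z dp Ux0 Ux1 cz Ez uz.
have [d0 d00 H0] := open_norm_ball oU Ux0.
have [d1 d10 H1] := open_norm_ball oU Ux1.
have [cx0 cx1 _ _] := dp.
exists (Num.min d0 d1 / N); first by rewrite divr_gt0// lt_min d00.
split=> [w cw|w cw wz].
  by rewrite uz -affine_minorantB; exact: affine_minorant_le.
have /cylinderE[Uw /andP[s0 s1]] := cw.
set t := time_part z in Ez; set s := time_part w in s0 s1.
pose b := (space_part w - space_part z) - (s - t) *: (x1 - x0).
have bN : `|b| <= N * `|w - z|.
  rewrite /N mulrDl mul1r; apply: le_trans (ler_normB _ _) _; apply: lerD.
    by rewrite -spaceB norm_space.
  rewrite normrZ mulrC; apply: ler_pM => //; last by rewrite -timeB norm_time.
  by apply: le_trans (ler_normB _ _) _; apply: lerD; exact: HM.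
have bd : `|b| < Num.min d0 d1.
  by apply: le_lt_trans bN _; rewrite mulrC -ltr_pdivlMr.
move: bd; rewrite lt_min => /andP[bd0 bd1].
have Ew : w = xt ((1 - s) *: (x0 + b) + s *: (x1 + b)) s.
  rewrite [LHS]xtE -/s; congr xt.
  rewrite (scalerDr (1 - s) x0 b) (scalerDr s x1 b) addrACA -(scalerDl b) subrK.
  rewrite scale1r /b {1}Ez space_xt.
  apply/rowP => i; rewrite !mxE; ring.
have s01 : 0 < s < 1 by rewrite s0.
have := geodesic_upper dp s01 (or_intror (conj Ux0 (H0 (x0 + b) _)))
  (or_intror (conj Ux1 (H1 (x1 + b) _))).
rewrite ![_ + b]addrC !addrK => /(_ bd0 bd1); rewrite ![b + _]addrC -Ew.
rewrite (affine_minorantB _ _ _ w z) -uz -mulrDl subrK mul1r => /le_trans; apply.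
rewrite lerD2l -mulrA ler_wpM2l// -exprMn !expr2 ler_pM//.
Qed.

(* With one minimizer at distance at least [rho] from the boundary and a weight
   at least [tau], only this minimizer is moved. *)
Lemma local_touching (tau rho : R) : 0 < tau -> 0 < rho ->
  exists K r : R, [/\ 0 <= K, 0 < r & forall x0 x1 p z,
    dual_pair U u0 u1 x0 x1 p -> cylinder U z ->
    z = xt ((1 - time_part z) *: x0 + time_part z *: x1) (time_part z) ->
    u z = affine_minorant x0 x1 p z ->
    (tau <= 1 - time_part z /\ forall y, `|y - x0| < rho -> U y) \/
    (tau <= time_part z /\ forall y, `|y - x1| < rho -> U y) ->
    touching (cylinder U) u z (slope x0 x1 p) K r].
Proof.
move=> tau0 rho0; have [M M0 HM] := closure_norm_le bU.
pose N := 1 + (M + M); have N0 : 0 < N by rewrite ltr_pwDl// addr_ge0.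
(* The moved point has weight above [tau / 2], so it travels at most [2 / tau] times the defect [d].
   The radius keeps this weight at [w] above [tau / 2] and the moved point within [rho] of its
   start. *)
pose k := N * 2 / tau; have k0 : 0 < k by rewrite divr_gt0// mulr_gt0.
exists (C * k ^+ 2), (Num.min (tau / 2) (rho / k)); split.
- by rewrite mulr_ge0// exprn_ge0// ltW.
- by rewrite lt_min (divr_gt0 tau0)// (divr_gt0 rho0 k0).
move=> x0 x1 p z dp cz Ez uz room; have [cx0 cx1 _ _] := dp.
split=> [w cw|w cw].
  by rewrite uz -affine_minorantB; exact: affine_minorant_le.
rewrite lt_min => /andP[wtau wrho].
have /cylinderE[Uw s01] := cw; case/andP: (s01) => s0 s1.
set t := time_part z in Ez room; set s := time_part w in s0 s1 s01.
have ts : `|s - t| < tau / 2 by rewrite -timeB (le_lt_trans (norm_time _)).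
pose d := (space_part w - space_part z) - (s - t) *: (x1 - x0).
have dN : `|d| <= N * `|w - z|.
  rewrite /N mulrDl mul1r; apply: le_trans (ler_normB _ _) _; apply: lerD.
    by rewrite -spaceB norm_space.
  rewrite normrZ mulrC; apply: ler_pM => //; last by rewrite -timeB norm_time.
  by apply: le_trans (ler_normB _ _) _; apply: lerD; exact: HM.
have Ed : space_part w = (1 - s) *: x0 + s *: x1 + d.
  by rewrite /d [in RHS]Ez space_xt; apply/rowP => i; rewrite !mxE; ring.
have small (a : R) : tau / 2 < a -> `|a^-1 *: d| <= k * `|w - z| /\ `|a^-1 *: d| < rho.
  move=> ta; have a0 : 0 < a by rewrite (lt_trans _ ta)// divr_gt0.
  suff le : `|a^-1 *: d| <= k * `|w - z|.
    by split=> //; apply: le_lt_trans le _; rewrite mulrC -ltr_pdivlMr.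
  rewrite normrZ gtr0_norm ?invr_gt0//.
  apply: (@le_trans _ _ ((tau / 2)^-1 * (N * `|w - z|))).
    apply: ler_pM => //; first by rewrite invr_ge0 ltW.
    by rewrite lef_pV2 ?posrE ?divr_gt0// ltW.
  by rewrite le_eqVlt /k; apply/orP; left; apply/eqP; field; rewrite gt_eqF.
have conclude y0 y1 : y0 = x0 \/ U x0 /\ U y0 -> y1 = x1 \/ U x1 /\ U y1 ->
    space_part w = (1 - s) *: y0 + s *: y1 ->
    (1 - s) * `|y0 - x0| ^+ 2 + s * `|y1 - x1| ^+ 2 <= (k * `|w - z|) ^+ 2 ->
    u w <= u z + dotprod (slope x0 x1 p) (w - z) + C * k ^+ 2 * `|w - z| ^+ 2.
  move=> H0 H1 Ey le; have := geodesic_upper dp s01 H0 H1.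
  rewrite -Ey -xtE (affine_minorantB _ _ _ w z) -uz => /le_trans; apply.
  by rewrite lerD2l -mulrA ler_wpM2l// -exprMn.
have sq a b' : 0 <= a <= 1 -> `|b'| <= k * `|w - z| ->
    a * `|b' : 'rV[R]_n| ^+ 2 <= (k * `|w - z|) ^+ 2.
  move=> /andP[a0 a1] b'k; rewrite -[leRHS]mul1r ler_pM// ?exprn_ge0//.
  by rewrite !expr2 ler_pM.
move: ts; rewrite ltr_norml => /andP[ts1 ts2].
case: room => -[tt ball].
- have s' : tau / 2 < 1 - s by lra.
  have [bk br] := small _ s'.
  have Ux0 : U x0 by apply: ball; rewrite subrr normr0.
  apply: (conclude (x0 + (1 - s)^-1 *: d) x1); [right; split=> //|by left| |].
  + by apply: ball; rewrite addrC addKr.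
  + rewrite Ed (scalerDr (1 - s) x0) scalerA divff ?scale1r 1?addrAC//.
    by rewrite gt_eqF// subr_gt0.
  + rewrite subrr normr0 expr0n mulr0 addr0 [x0 + _]addrC addrK sq//.
    by rewrite subr_ge0 (ltW s1) gerBl ltW.
- have s' : tau / 2 < s by lra.
  have [bk br] := small _ s'.
  have Ux1 : U x1 by apply: ball; rewrite subrr normr0.
  apply: (conclude x0 (x1 + s^-1 *: d)); [by left|right; split=> //| |].
  + by apply: ball; rewrite addrC addKr.
  + by rewrite Ed (scalerDr s x1) scalerA divff ?scale1r ?addrA// gt_eqF.
  + rewrite subrr normr0 expr0n mulr0 add0r [x1 + _]addrC addrK sq//.
    by rewrite !ltW.
Qed.

(** At a single point, openness of [U] gives the interior member some room [rho], and the smaller of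
    the two weights serves as [tau]. *)
Lemma geodesic_gradient x0 x1 p (t : R) : dual_pair U u0 u1 x0 x1 p ->
  U x0 \/ U x1 -> 0 < t < 1 -> U ((1 - t) *: x0 + t *: x1) ->
  let z := xt ((1 - t) *: x0 + t *: x1) t in
  differentiable u z /\ grad u z = slope x0 x1 p.
Proof.
move=> dp Ux t01 Uz z; have cz : cylinder U z by exact: cylinder_xt.
have Ez : z = xt ((1 - time_part z) *: x0 + time_part z *: x1) (time_part z).
  by rewrite /z time_xt.
have uz : u z = affine_minorant x0 x1 p z.
  by rewrite affine_minorant_dual (geodesic_dual dp).
have [rho rho0 room] : exists2 rho : R, 0 < rho &
    (forall y, `|y - x0| < rho -> U y) \/ (forall y, `|y - x1| < rho -> U y).
  case: Ux => Ux; have [rho rho0 H] := open_norm_ball oU Ux; exists rho => //.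
    by left.
  by right.
case/andP: (t01) => t0 t1.
have tau0 : 0 < Num.min t (1 - t) by rewrite lt_min t0 subr_gt0.
have [K [r [K0 r0 H]]] := local_touching tau0 rho0.
apply: (touching_grad (open_cylinder oU) cz r0); apply: (H _ _ _ _ dp cz Ez uz).
rewrite time_xt; case: room => room; [left|right]; split => //.
  by rewrite ge_min lexx orbT.
by rewrite ge_min lexx.
Qed.

Lemma geodesic_gradient_at z : cylinder U z -> exists x0 x1 p,
  [/\ dual_pair U u0 u1 x0 x1 p, U x0 \/ U x1,
      z = xt ((1 - time_part z) *: x0 + time_part z *: x1) (time_part z),
      differentiable u z & grad u z = slope x0 x1 p].
Proof.
move=> cz; have /cylinderE[Uz t01] := cz.
have [x0 [x1 [p [dp Ux Ez _ _]]]] := geodesic_touch cz.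
have Uz' : U ((1 - time_part z) *: x0 + time_part z *: x1).
  by move: Uz; rewrite {1}Ez space_xt.
have [] := geodesic_gradient dp Ux t01 Uz'.
by rewrite -Ez; exists x0, x1, p.
Qed.

Lemma grad_support z w : cylinder U z -> cylinder U w ->
  u z + dotprod (grad u z) (w - z) <= u w.
Proof.
move=> cz cw; have [x0 [x1 [p [dp Ux Ez _ ->]]]] := geodesic_gradient_at cz.
have /cylinderE[Uz t01] := cz.
have Uz' : U ((1 - time_part z) *: x0 + time_part z *: x1).
  by move: Uz; rewrite {1}Ez space_xt.
have uz : u z = affine_minorant x0 x1 p z.
  by rewrite {1}Ez [in RHS]Ez affine_minorant_dual (geodesic_dual dp).
by rewrite uz -affine_minorantB; exact: affine_minorant_le.
Qed.

Lemma grad_geodesic_bounded : exists2 B : R, 0 <= B &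
  forall z, cylinder U z -> `|grad u z| <= B.
Proof.
have [B B0 HB] := slope_bounded; exists B => // z cz.
by have [x0 [x1 [p [dp Ux _ _ ->]]]] := geodesic_gradient_at cz; exact: HB.
Qed.

Lemma geodesic_bounded : exists B : R, forall z, cylinder U z -> `|u z| <= B.
Proof.
have /compact_bounded/ex_strict_bound_gt0[B B0 HB] :=
  continuous_compact cu compact_closure_cylinder.
by exists B => z cz; apply/ltW/HB; exists z => //; exact: subset_closure.
Qed.

Lemma touching_grad_lipschitz z w (K r : R) : 0 <= K -> 0 < r ->
  cylinder U z -> cylinder U w -> touching (cylinder U) u z (grad u z) K r ->
  (forall y, `|y - w| <= `|w - z| -> cylinder U y) -> 2 * `|w - z| < r ->
  `|grad u w - grad u z| <= 4 * K * `|w - z|.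
Proof.
move=> K0 r0 cz cw tz room wr.
have [->|wz] := eqVneq w z; first by rewrite !subrr !normr0 mulr0.
apply: (touching_subgradient_lipschitz K0 tz _ room wz wr) => y cy.
exact: grad_support.
Qed.

Lemma touching_cylinder z x0 x1 p : dual_pair U u0 u1 x0 x1 p -> cylinder U z ->
  z = xt ((1 - time_part z) *: x0 + time_part z *: x1) (time_part z) ->
  u z = affine_minorant x0 x1 p z /\
  u z = (1 - time_part z) * u0 x0 + time_part z * u1 x1.
Proof.
move=> dp cz Ez; have /cylinderE[Uz t01] := cz.
have Uz' : U ((1 - time_part z) *: x0 + time_part z *: x1).
  by move: Uz; rewrite {1}Ez space_xt.
split; last by rewrite {1}Ez (geodesic_dual dp).
by rewrite {1}Ez [in RHS]Ez affine_minorant_dual (geodesic_dual dp).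
Qed.

(** * Local regularity *)

Lemma geodesic_lt0 z : cylinder U z -> u z < 0.
Proof.
move=> cz; have /cylinderE[Uz t01] := cz; have clz := subset_closure Uz.
have := geodesic_le clz clz t01; rewrite -scalerDl subrK scale1r -xtE.
move=> /le_lt_trans; apply; case/andP: t01 => t0 t1.
have lt0 := pinched_lt0 oU bU cu0 u0bd pu0 n_gt0 Uz.
have lt1 := pinched_lt0 oU bU cu1 u1bd pu1 n_gt0 Uz.
have : (1 - time_part z) * u0 (space_part z) < 0.
  by rewrite pmulr_rlt0// subr_gt0.
have : time_part z * u1 (space_part z) < 0 by rewrite pmulr_rlt0.
lra.
Qed.

(** On a compact set [u] is bounded above by a negative number. As [u z] is the weighted mean of
    [u0 x0] and [u1 x1], one of these is below the same bound, and that point keeps a uniform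
    distance from the boundary. The times stay uniformly inside (0,1), which bounds both weights
    from below. *)
Lemma compact_touching V : compact V -> V `<=` cylinder U ->
  exists K r : R, [/\ 0 <= K, 0 < r & forall z, V z ->
    touching (cylinder U) u z (grad u z) K r /\
    forall y, `|y - z| < r -> cylinder U y].
Proof.
move=> cV VU; have [V0|V0] := pselect (V !=set0); last first.
  by exists 0, 1; split => // z Vz; exfalso; apply: V0; exists z.
have [r1 r10 Hr1] := compact_uniform_ball cV (open_cylinder oU) VU.
have cuV : {within V, continuous u}.
  apply/within_continuous_normP => z Vz e e0.
  have [d d0 H] := (within_continuous_normP _ _).1 cu z
    (subset_closure (VU _ Vz)) e e0.
  by exists d => // y Vy; apply: H; exact/subset_closure/VU.
have [zm + maxz] := compact_EVT_max V0 cV cuV; rewrite inE => Vzm.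
have eta0 : 0 < - u zm by rewrite oppr_gt0 geodesic_lt0//; exact: VU.
have [rho0 rho00 Hrho0] := sublevel_uniform_ball oU bU cu0 u0bd eta0.
have [rho1 rho10 Hrho1] := sublevel_uniform_ball oU bU cu1 u1bd eta0.
have rho_gt0 : 0 < Num.min rho0 rho1 by rewrite lt_min rho00.
have tau_gt0 : 0 < r1 / 2 by rewrite divr_gt0.
have [K [r [K0 r0 H]]] := local_touching tau_gt0 rho_gt0.
exists K, (Num.min r r1); split => //; first by rewrite lt_min r0.
move=> z Vz; have cz := VU z Vz; split; last first.
  by move=> y; rewrite lt_min => /andP[_]; exact: Hr1.
have [x0 [x1 [p [dp _ Ez _ ->]]]] := geodesic_gradient_at cz.
have [uz uz'] := touching_cylinder dp cz Ez.
suff : touching (cylinder U) u z (slope x0 x1 p) K r.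
  case=> lo up; split => // w cw; rewrite lt_min => /andP[wr _]; exact: up.
apply: (H _ _ _ _ dp cz Ez uz); have [cx0 cx1 _ _] := dp.
have [_ /andP[t0 t1]] := (cylinderE _ _).1 cz.
have shift (a : R) : `|a| < r1 -> 0 < time_part z + a < 1.
  move=> ar; have [] := (cylinderE U (z + xt 0 a)).1 _.
    apply: Hr1 Vz _; rewrite addrC addKr; apply: (@le_lt_trans _ _ `|a|) => //.
    by apply: norm_xt; rewrite ?normr0.
  suff -> : time_part (z + xt 0 a) = time_part z + a by [].
  by rewrite {1}(xtE z) xtD time_xt.
have tau1 : r1 / 2 <= 1 - time_part z.
  have /shift/andP[_] : `|r1 / 2| < r1 by rewrite gtr0_norm//; lra.
  lra.
have tau0 : r1 / 2 <= time_part z.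
  have /shift/andP[] : `|- (r1 / 2)| < r1 by rewrite normrN gtr0_norm//; lra.
  lra.
have [le0|gt0] := leP (u0 x0) (- - u zm).
  left; split => // y; rewrite lt_min => /andP[yr _]; exact: Hrho0 yr.
right; split => // y; rewrite lt_min => /andP[_ yr]; apply: Hrho1 yr => //.
have := maxz z (mem_set Vz); rewrite uz' => lem.
rewrite -(ler_pM2l t0).
have : (1 - time_part z) * (- - u zm) < (1 - time_part z) * u0 x0.
  by rewrite ltr_pM2l ?subr_gt0.
move: lem; lra.
Qed.

Lemma geodesic_C11_loc : C11_loc (cylinder U) u.
Proof.
move=> V oV cV VU.
have [K [r [K0 r0 H]]] := compact_touching cV VU.
have [B B0 HB] := grad_geodesic_bounded.
have VU' z : V z -> cylinder U z by move=> /subset_closure/VU.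
split.
- by move=> z /VU'/geodesic_gradient_at[x0 [x1 [p []]]].
- by have [D HD] := geodesic_bounded; apply: (@bounded_in _ _ _ _ _ D) => z /VU'/HD.
- by apply: (@bounded_in _ _ _ _ _ B) => z /VU'/HB.
apply/lipschitz_inP; exists (4 * K + 4 * B / r) => w z Vw Vz.
have c0 : 0 <= 4 * K by rewrite mulr_ge0.
have c1 : 0 <= 4 * B / r by rewrite divr_ge0 ?mulr_ge0// ltW.
(* At small distances the touching paraboloids apply. At distances at least [r / 2] the gradient
   bound suffices, since [B + B] is then at most [4 * B / r] times the distance. *)
have [lt|ge] := ltP (2 * `|w - z|) r.
  apply: (@le_trans _ _ (4 * K * `|w - z|)); last by rewrite ler_wpM2r// lerDl.
  have [tz room] := H z (subset_closure Vz).
  apply: (touching_grad_lipschitz K0 r0 (VU' _ Vz) (VU' _ Vw) tz _ lt) => y yw.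
  apply: room; have -> : y - z = (y - w) + (w - z) by rewrite addrA subrK.
  apply: le_lt_trans (ler_normD _ _) _; move: yw lt; lra.
apply: (@le_trans _ _ (4 * B / r * `|w - z|)); last by rewrite ler_wpM2r// lerDr.
apply: (@le_trans _ _ (B + B)).
  apply: le_trans (ler_normB _ _) _; apply: lerD; apply: HB; exact: VU'.
rewrite mulrAC ler_pdivlMr//.
have := ler_wpM2l B0 ge; lra.
Qed.

(** * Global regularity and gradient images *)

Lemma interior_C11 : (forall x0 x1 p, dual_pair U u0 u1 x0 x1 p ->
    U x0 \/ U x1 -> U x0 /\ U x1) -> C11 (cylinder U) u.
Proof.
move=> int; have [K K0 H] := interior_touching.
have [B B0 HB] := grad_geodesic_bounded.
split.
- by move=> z /geodesic_gradient_at[x0 [x1 [p []]]].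
- by have [D HD] := geodesic_bounded; apply: (@bounded_in _ _ _ _ _ D).
- exact: (@bounded_in _ _ _ _ _ B).
apply/lipschitz_inP; exists (4 * K) => w z cw cz.
have touch y : cylinder U y -> exists2 r : R, 0 < r &
    touching (cylinder U) u y (grad u y) K r.
  move=> cy; have [x0 [x1 [p [dp Ux Ez _ ->]]]] := geodesic_gradient_at cy.
  have [Ux0 Ux1] := int _ _ _ dp Ux.
  by have [uz _] := touching_cylinder dp cy Ez; exact: H dp Ux0 Ux1 cy Ez uz.
(* The opening [K] is uniform but the touching radius is not, so the estimate is propagated along
   the segment from [z] to [w], one coordinate of the gradient at a time. *)
pose y (s : R) := z + s *: (w - z).
have cy s : 0 <= s <= 1 -> cylinder U (y s).
  move=> s01; have /cylinderE[Uz t01] := cz; have /cylinderE[Uw t01'] := cw.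
  apply/cylinderE; rewrite /y; split.
    by rewrite (xtE z) (xtE w) xtB xtZ xtD space_xt; apply: domain_convex.
  rewrite (xtE z) (xtE w) xtB xtZ xtD time_xt.
  case/andP: t01 => z0 z1; case/andP: t01' => w0 w1; case/andP: s01 => s0 s1.
  move: z0 z1 w0 w1; set a := time_part z; set b := time_part w => z0 z1 w0 w1.
  have s1' : 0 <= 1 - s by rewrite subr_ge0.
  have [ab|/ltW ab] := leP a b.
    have ab' : 0 <= b - a by rewrite subr_ge0.
    have h0 := mulr_ge0 s0 ab'; have h1 := mulr_ge0 s1' ab'.
    by apply/andP; split; lra.
  have ab' : 0 <= a - b by rewrite subr_ge0.
  have h0 := mulr_ge0 s0 ab'; have h1 := mulr_ge0 s1' ab'.
  by apply/andP; split; lra.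
apply: norm_le_coord => [|i]; first by rewrite !mulr_ge0.
have -> : (grad u w - grad u z) 0 i = grad u (y 1) 0 i - grad u (y 0) 0 i.
  by rewrite /y scale1r scale0r addr0 [z + _]addrC subrK !mxE.
apply: (@pointwise_lipschitz R (fun s => grad u (y s) 0 i)) => s s01.
have [r r0 tys] := touch _ (cy s s01).
have [r' r'0 room] := open_norm_ball (open_cylinder oU) (cy s s01).
have k0 : 0 < 2 * `|w - z| + 1 by rewrite ltr_wpDl// mulr_ge0.
exists (Num.min r r' / (2 * `|w - z| + 1)).
  by rewrite divr_gt0// lt_min r0.
move=> s' s'01; rewrite ltr_pdivlMr// => ss'.
have Ey : y s' - y s = (s' - s) *: (w - z).
  by rewrite /y opprD addrACA subrr add0r scalerBl.
have ny : `|y s' - y s| = `|s' - s| * `|w - z| by rewrite Ey normrZ.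
have : 2 * `|y s' - y s| < Num.min r r'.
  by apply: le_lt_trans ss'; rewrite ny; have := normr_ge0 (s' - s); lra.
rewrite lt_min => /andP[yr yr'].
have -> : grad u (y s') 0 i - grad u (y s) 0 i = (grad u (y s') - grad u (y s)) 0 i.
  by rewrite !mxE.
apply: le_trans (coord_le_norm _ _) _.
rewrite [X in _ <= X](_ : _ = 4 * K * `|y s' - y s|); last by rewrite ny; ring.
apply: touching_grad_lipschitz K0 r0 (cy s s01) (cy s' s'01) tys _ yr => y' y'y.
apply: room; have -> : y' - y s = (y' - y s') + (y s' - y s) by rewrite addrA subrK.
apply: le_lt_trans (ler_normD _ _) _; move: y'y yr'; lra.
Qed.

(** If [x0] is interior, [p] is a gradient of [u0], hence of [u1] at some [y] in [U], and strict
    support forces [x1 = y]. The other case is symmetric. *)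
Lemma equal_images_interior :
  subdiff_image U u0 U = subdiff_image U u1 U ->
  forall x0 x1 p, dual_pair U u0 u1 x0 x1 p -> U x0 \/ U x1 -> U x0 /\ U x1.
Proof.
move=> img x0 x1 p dp; have [cx0 cx1 sub0 sub1] := dp.
case=> [Ux0|Ux1]; split => //.
- have : subdiff_image U u1 U p.
    by rewrite -img; exists x0 => // y Uy; apply: sub0; exact: subset_closure.
  case=> y Uy suby; have Ep := subgradient_unique oU Uy pu1 suby.
  rewrite Ep in sub1.
  by rewrite (subgradient_point_unique sU cu1 pu1 cx1 Uy sub1).
- have : subdiff_image U u0 U p.
    by rewrite img; exists x1 => // y Uy; apply: sub1; exact: subset_closure.
  case=> y Uy suby; have Ep := subgradient_unique oU Uy pu0 suby.
  rewrite Ep in sub0.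
  by rewrite (subgradient_point_unique sU cu0 pu0 cx0 Uy sub0).
Qed.

(** Both segments are observed at the same time [t], so only their spatial distance remains, and [p]
    is the spatial part of the gradient. Distinct endpoints keep the open segments inside [U] by
    strict convexity. *)
Lemma grad_lipschitz_dual : [lipschitz grad u z | z in cylinder U] ->
  exists2 k : R, 0 <= k & forall x0 x1 p x0' x1' p' (t : R),
    dual_pair U u0 u1 x0 x1 p -> dual_pair U u0 u1 x0' x1' p' ->
    U x0 /\ U x0' \/ U x1 /\ U x1' -> x0 != x1 -> x0' != x1' -> 0 < t < 1 ->
    `|p - p'| <= k * `|(1 - t) *: (x0 - x0') + t *: (x1 - x1')|.
Proof.
move=> /lipschitz_inP[k Hk]; exists `|k| => //.
move=> x0 x1 p x0' x1' p' t dp dp' Ux x01 x01' t01.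
have [cx0 cx1 _ _] := dp; have [cx0' cx1' _ _] := dp'.
have Uz : U ((1 - t) *: x0 + t *: x1) by rewrite segmentE; exact: open_segment.
have Uz' : U ((1 - t) *: x0' + t *: x1') by rewrite segmentE; exact: open_segment.
have [Ux01 Ux01'] : (U x0 \/ U x1) /\ (U x0' \/ U x1').
  by case: Ux => -[? ?]; split; [left|left|right|right].
have [_ g] := geodesic_gradient dp Ux01 t01 Uz.
have [_ g'] := geodesic_gradient dp' Ux01' t01 Uz'.
have := Hk _ _ (cylinder_xt Uz t01) (cylinder_xt Uz' t01).
rewrite g g' => le.
have Ep : p - p' = space_part (slope x0 x1 p - slope x0' x1' p').
  by rewrite spaceB /slope !space_xt.
rewrite Ep; apply: le_trans (norm_space _) _; apply: le_trans le _.
have -> : xt ((1 - t) *: x0 + t *: x1) t - xt ((1 - t) *: x0' + t *: x1') t =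
    xt ((1 - t) *: (x0 - x0') + t *: (x1 - x1')) 0.
  by rewrite xtB subrr !scalerBr opprD addrACA.
apply: le_trans (ler_wpM2r _ (ler_norm k)) _ => //.
by rewrite ler_wpM2l//; apply: norm_xt; rewrite ?normr0.
Qed.

(** Where [f x = 0] the support inequality gives [p . (y - x) <= f y <= 0], so adding a positive
    multiple of [p] to the slope can only lower the hyperplane over the closure. A zero [p] would
    make [f] nonnegative inside. *)
Lemma boundary_dual_pair_eq0 f x p : (forall y, U y -> f y < 0) ->
  f x = 0 -> (forall y, closure U y -> f x + dotprod p (y - x) <= f y) ->
  {within closure U, continuous f} -> (forall y, boundary U y -> f y = 0) ->
  p != 0 /\ forall e : R, 0 < e -> forall y, closure U y ->
    f x + dotprod ((1 + e) *: p) (y - x) <= f y.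
Proof.
move=> flt0 fx sub cf fbd.
split.
  apply/eqP => p0; have [y Uy] := U_neq0.
  by have := sub y (subset_closure Uy); have := flt0 y Uy; rewrite p0 dotprod0l; lra.
move=> e e0 y cy.
have fy : f y <= 0.
  have [/flt0/ltW//|nUy] := pselect (U y).
  by rewrite fbd//; exact: closureD_boundary.
have := sub y cy; rewrite fx !add0r dotprodZl => suby.
have : e * dotprod p (y - x) <= 0.
  by rewrite pmulr_rle0//; exact: le_trans suby fy.
by move: suby; lra.
Qed.

Lemma C11_image_sub01 : C11 (cylinder U) u ->
  subdiff_image U u0 U `<=` subdiff_image U u1 U.
Proof.
case=> _ _ _ /grad_lipschitz_dual[k k0 Hk] p [x0 Ux0 sub].
have Ep := subgradient_unique oU Ux0 pu0 sub.
have sub0 y : closure U y -> u0 x0 + dotprod p (y - x0) <= u0 y.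
  by move=> cy; rewrite Ep; exact: (pinched_support sU cu0 pu0).
have [x1 cx1 sub1] := exists_subgradient_point bU cu1 p U_neq0.
have [Ux1|nUx1] := pselect (U x1).
  by exists x1 => // y Uy; apply: sub1; exact: subset_closure.
exfalso.
have bx1 := closureD_boundary cx1 nUx1.
have lt1 y (Uy : U y) := pinched_lt0 oU bU cu1 u1bd pu1 n_gt0 Uy.
have [p0 dil] := boundary_dual_pair_eq0 lt1 (u1bd bx1) sub1 cu1 u1bd.
have [e [x0' [e0 Ux0' sub0']]] :=
  subgradient_image_dilation oU bU sU cu0 pu0 Ux0.
rewrite -Ep in sub0'.
have dp : dual_pair U u0 u1 x0 x1 p by split => //; exact: subset_closure.
have dp' : dual_pair U u0 u1 x0' x1 ((1 + e) *: p).
  by split => //; [exact: subset_closure|exact: dil].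
have x01 : x0 != x1 by apply/eqP => E; apply: nUx1; rewrite -E.
have x01' : x0' != x1 by apply/eqP => E; apply: nUx1; rewrite -E.
(* The two segments end at the same point [x1]: at time [1 - s] their distance is [s] times that of
   [x0] and [x0'], while their slopes differ by the fixed nonzero vector [e *: p]. Letting [s] tend
   to 0 contradicts the Lipschitz bound. *)
suff : 0 <= - `|p - (1 + e) *: p|.
  rewrite oppr_ge0 normr_le0 scalerDl scale1r opprD addrA subrr add0r oppr_eq0.
  by rewrite scaler_eq0 (negbTE p0) orbF gt_eqF.
apply: (@ge0_limit _ _ (k * `|x0 - x0'|) 1) => // s /andP[s0 s1].
have t01 : 0 < 1 - s < 1 by rewrite subr_gt0 s1 gtrBl.
have := Hk _ _ _ _ _ _ _ dp dp' (or_introl (conj Ux0 Ux0')) x01 x01' t01.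
by rewrite subrr scaler0 addr0 subKr normrZ gtr0_norm//; lra.
Qed.

(** The argument of [C11_image_sub01] with the two times exchanged: the segments now issue from the
    common point [x0], and [t] tends to 0. *)
Lemma C11_image_sub10 : C11 (cylinder U) u ->
  subdiff_image U u1 U `<=` subdiff_image U u0 U.
Proof.
case=> _ _ _ /grad_lipschitz_dual[k k0 Hk] p [x1 Ux1 sub].
have Ep := subgradient_unique oU Ux1 pu1 sub.
have sub1 y : closure U y -> u1 x1 + dotprod p (y - x1) <= u1 y.
  by move=> cy; rewrite Ep; exact: (pinched_support sU cu1 pu1).
have [x0 cx0 sub0] := exists_subgradient_point bU cu0 p U_neq0.
have [Ux0|nUx0] := pselect (U x0).
  by exists x0 => // y Uy; apply: sub0; exact: subset_closure.
exfalso.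
have bx0 := closureD_boundary cx0 nUx0.
have lt0 y (Uy : U y) := pinched_lt0 oU bU cu0 u0bd pu0 n_gt0 Uy.
have [p0 dil] := boundary_dual_pair_eq0 lt0 (u0bd bx0) sub0 cu0 u0bd.
have [e [x1' [e0 Ux1' sub1']]] :=
  subgradient_image_dilation oU bU sU cu1 pu1 Ux1.
rewrite -Ep in sub1'.
have dp : dual_pair U u0 u1 x0 x1 p by split => //; exact: subset_closure.
have dp' : dual_pair U u0 u1 x0 x1' ((1 + e) *: p).
  by split => //; [exact: subset_closure|exact: dil].
have x01 : x0 != x1 by apply/eqP => E; apply: nUx0; rewrite E.
have x01' : x0 != x1' by apply/eqP => E; apply: nUx0; rewrite E.
suff : 0 <= - `|p - (1 + e) *: p|.
  rewrite oppr_ge0 normr_le0 scalerDl scale1r opprD addrA subrr add0r oppr_eq0.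
  by rewrite scaler_eq0 (negbTE p0) orbF gt_eqF.
apply: (@ge0_limit _ _ (k * `|x1 - x1'|) 1) => // t t01.
have := Hk _ _ _ _ _ _ _ dp dp' (or_intror (conj Ux1 Ux1')) x01 x01' t01.
case/andP: t01 => t0 t1.
by rewrite subrr scaler0 add0r normrZ gtr0_norm//; lra.
Qed.

End geodesic.

Lemma pinchedW (R : realType) (m : nat) (U : set 'rV[R]_m) f (C L C' L' : R) :
  C <= C' -> L <= L' -> pinched U f C L -> pinched U f C' L'.
Proof.
move=> CC LL [gL p2]; split=> [x Ux|x y Ux Uy xy].
  by rewrite (le_trans (gL x Ux)).
have /andP[-> up] := p2 x y Ux Uy xy; rewrite (le_trans up)// lerD2l.
by rewrite ler_wpM2r// exprn_ge0.
Qed.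

Theorem theorem0p2 (R : realType) (n : nat) (n_gt0 : (0 < n)%N)
    (U : set 'rV[R]_n) (domU : smooth_strictly_convex_domain U)
    (u0 u1 : 'rV[R]_n -> R) (Su0 : in_tildeS U u0) (Su1 : in_tildeS U u1)
    (u : 'rV[R]_(n + 1) -> R) (geod_u : weak_geodesic U u0 u1 u) :
  [/\ [lipschitz u z | z in cylinder U],
      C11_loc (cylinder U) u &
      C11 (cylinder U) u <-> subdiff_image U u0 U = subdiff_image U u1 U].
Proof.
have [oU U_neq0 bU _ sU] := domU.
have cvxU x y (s : R) : U x -> U y -> 0 <= s <= 1 -> U (x + s *: (y - x)).
  exact: domain_convex.
have [C0 [L0 [C00 L00 pu0]]] := tildeS_pinched oU cvxU Su0.
have [C1 [L1 [C10 L10 pu1]]] := tildeS_pinched oU cvxU Su1.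
have [_ cu0 _ _ u0bd] := Su0; have [_ cu1 _ _ u1bd] := Su1.
(* Summing the constants lets both functions be pinched with the same pair. *)
have {}pu0 : pinched U u0 (C0 + C1) (L0 + L1).
  by apply: pinchedW pu0; rewrite lerDl.
have {}pu1 : pinched U u1 (C0 + C1) (L0 + L1).
  by apply: pinchedW pu1; rewrite lerDr.
have C_ge0 : 0 <= C0 + C1 by rewrite addr_ge0.
have L_ge0 : 0 <= L0 + L1 by rewrite addr_ge0.
split.
- apply/lipschitz_inP.
  have [B _ HB] := geodesic_lipschitz_bound n_gt0 oU bU sU cu0 cu1 u0bd u1bd
    pu0 pu1 U_neq0 geod_u L_ge0.
  by exists B.
- exact: (geodesic_C11_loc n_gt0 oU bU sU cu0 cu1 u0bd u1bd pu0 pu1 U_neq0).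
split=> [C11u|img].
  apply/seteqP; split.
    exact: (C11_image_sub01 n_gt0 oU bU sU cu0 cu1 u0bd u1bd pu0 pu1 U_neq0 geod_u).
  exact: (C11_image_sub10 n_gt0 oU bU sU cu0 cu1 u0bd u1bd pu0 pu1 U_neq0 geod_u).
apply: (interior_C11 n_gt0 oU bU sU cu0 cu1 u0bd u1bd pu0 pu1 U_neq0 geod_u) => //.
exact: (equal_images_interior oU sU cu0 cu1 pu0 pu1 img).
Qed.
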